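(* Let $(X,f)$ be the $\pi$-calculus dialgebra. For all $\pi$-calculus processes $P,Q$, $P$ and $Q$ are dialgebraically bisimilar in $(X,f)$ if and only if $P$ and $Q$ are strong barbed equivalent ($P\simeq Q$).
   Context: Functors: $\mathsf{F}(X)=X+(X\times X)$, $\mathsf{F}h(x)=h(x)$, $\mathsf{F}h(x,y)=(h(x),h(y))$ (elements written without tags); $\mathsf{B}(X)=\mathcal{P}(X)$, $\mathsf{B}h(S)=h[S]$. An $(\mathsf{F},\mathsf{B})$-dialgebra is a pair $(X,f)$ with $f:\mathsf{F}X\to\mathsf{B}X$; a homomorphism $h:(X,f)\to(Y,g)$ is a function with $g\circ\mathsf{F}h=\mathsf{B}h\circ f$. Dialgebraic bisimilarity: $x\sim_f y$ iff there exist $(Y,g)$ and a homomorphism $h:(X,f)\to(Y,g)$ with $h(x)=h(y)$. $\pi$-calculus (without matching and recursion). Names range over a countable set. Prefixes: $\alpha::=\tau\mid a(x)\mid\bar a x$; processes: $P::=\sum_{i\in I}\alpha_i.P_i\mid P_1\parallel P_2\mid(\nu a)P$ with $I$ finite, sums taken up to reordering; $\mathbf{0}$ is the empty sum and $\alpha.P+Q$ denotes a sum with summand $\alpha.P$. In $a(x).P$ the name $x$ is bound in $P$, and in $(\nu a)P$ the name $a$ is bound; $\mathit{fn}$ denotes free names; $Q[b/y]$ is capture-avoiding substitution. $X$ is the set of processes. Structural congruence $\equiv$ is the least congruence containing $\alpha$-conversion of bound names (in restrictions and input prefixes), the commutative monoid laws for $\parallel$ with unit $\mathbf{0}$, and $(\nu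 a)(P\parallel Q)\equiv((\nu a)P)\parallel Q$ if $a\notin\mathit{fn}(Q)$, $(\nu a)\mathbf{0}\equiv\mathbf{0}$, $(\nu a)(\nu b)P\equiv(\nu b)(\nu a)P$. The $\pi$-calculus dialgebra is the $(\mathsf{F},\mathsf{B})$-dialgebra $(X,f)$ where $f$ is the least function (writing $P\to R$ for $R\in f(P)$ and $(P,Q)\to R$ for $R\in f(P,Q)$) closed under: (tau) $\tau.P+Q\to P$; (res) $P\to P'$ implies $(\nu a)P\to(\nu a)P'$; (par$_1$) $P\to P'$ implies $P\parallel Q\to P'\parallel Q$; (int) $(P,Q)\to R$ implies $P\parallel Q\to R$; (hid) $(P,Q)\to R$ and $a\notin\mathit{fn}(Q)$ imply $((\nu a)P,Q)\to(\nu a)R$; (par$_2$) $(P,Q)\to R$ implies $(P\parallel S,Q)\to S\parallel R$; (com) $(\bar a b.P+S,a(y).Q+T)\to P\parallel Q[b/y]$; (sym) $(P,Q)\to R$ implies $(Q,P)\to R$; (str$_1$) $P\to R$, $P\equiv Q$, $R\equiv S$ imply $Q\to S$; (str$_2$) $(P,Q)\to R$, $P\equiv S$, $Q\equiv T$, $R\equiv U$ imply $(S,T)\to U$. Let $\xrightarrow{\ell}$ be the standard early labelled transition semantics of the $\pi$-calculus (labels $\tau$, $\bar a b$, $ab$, $\bar a(b)$). The observability predicate $P\downarrow_a$ holds iff $P$ can perform an input on $a$, and $P\downarrow_{\bar a}$ iff $P$ can perform an output (free or bound) on $a$. Strong barbed bisimilarity $\stackrel{\cdot}{\sim}$ is the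 largest symmetric relation such that whenever $P\stackrel{\cdot}{\sim}Q$: $P\downarrow_\mu$ implies $Q\downarrow_\mu$ for every $\mu$ of the form $a$ or $\bar a$, and $P\xrightarrow{\tau}P'$ implies there is $Q'$ with $Q\xrightarrow{\tau}Q'$ and $P'\stackrel{\cdot}{\sim}Q'$. Strong barbed equivalence: $P\simeq Q$ iff for all processes $R$, $P\parallel R\stackrel{\cdot}{\sim}Q\parallel R$. *)

(* Defs.v *)
From Stdlib Require Import List Permutation Arith PeanoNat.
Import ListNotations.

Definition name := nat.

Inductive prefix : Type :=
| PTau : prefix
| PIn  : name -> name -> prefix     (* a(x) : x bound *)
| POut : name -> name -> prefix.

(* Processes: finite guarded sums (as lists; reordering is identified by
   alpha-equivalence/structural congruence below), parallel, restriction. *)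
Inductive proc : Type :=
| PSum : list (prefix * proc) -> proc
| PPar : proc -> proc -> proc
| PNu  : name -> proc -> proc.

Definition PNil : proc := PSum [].

Definition rem (x : name) (l : list name) : list name :=
  filter (fun y => negb (Nat.eqb y x)) l.

Definition fn_pre (a : prefix) (L : list name) : list name :=
  match a with
  | PTau => L
  | PIn a x => a :: rem x L
  | POut a b => a :: b :: L
  end.

Fixpoint fn (P : proc) : list name :=
  match P with
  | PSum l =>
      (fix go (l : list (prefix * proc)) : list name :=
         match l with
         | [] => []
         | (a, Q) :: l' => fn_pre a (fn Q) ++ go l'
         end) l
  | PPar P Q => fn P ++ fn Q
  | PNu a P => rem a (fn P)
  end.

Definition fresh (L : list name) : name := S (list_max L).

Definition upd (s : name -> name) (x z : name) : name -> name :=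
  fun n => if Nat.eqb n x then z else s n.

Fixpoint subst (s : name -> name) (P : proc) : proc :=
  match P with
  | PSum l =>
      PSum ((fix go (l : list (prefix * proc)) : list (prefix * proc) :=
              match l with
              | [] => []
              | (PTau, Q) :: l' => (PTau, subst s Q) :: go l'
              | (POut a b, Q) :: l' => (POut (s a) (s b), subst s Q) :: go l'
              | (PIn a x, Q) :: l' =>
                  let z := fresh (map s (rem x (fn Q))) in
                  (PIn (s a) z, subst (upd s x z) Q) :: go l'
              end) l)
  | PPar P Q => PPar (subst s P) (subst s Q)
  | PNu a P =>
      let z := fresh (map s (rem a (fn P))) in
      PNu z (subst (upd s a z) P)
  end.

Definition subst1 (Q : proc) (b y : name) : proc := subst (upd (fun n => n) y b) Q.

Inductive aeq : proc -> proc -> Prop :=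
| aeq_refl P : aeq P P
| aeq_sym P Q : aeq P Q -> aeq Q P
| aeq_trans P Q R : aeq P Q -> aeq Q R -> aeq P R
| aeq_par_l P P' Q : aeq P P' -> aeq (PPar P Q) (PPar P' Q)
| aeq_par_r P Q Q' : aeq Q Q' -> aeq (PPar P Q) (PPar P Q')
| aeq_nu a P P' : aeq P P' -> aeq (PNu a P) (PNu a P')
| aeq_sum l1 l2 a P P' : aeq P P' ->
    aeq (PSum (l1 ++ (a, P) :: l2)) (PSum (l1 ++ (a, P') :: l2))
| aeq_perm l l' : Permutation l l' -> aeq (PSum l) (PSum l')
| aeq_alpha_nu a z P : ~ In z (fn (PNu a P)) ->
    aeq (PNu a P) (PNu z (subst1 P z a))
| aeq_alpha_in l1 l2 a x z P : ~ In z (rem x (fn P)) ->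
    aeq (PSum (l1 ++ (PIn a x, P) :: l2))
        (PSum (l1 ++ (PIn a z, subst1 P z x) :: l2)).

Inductive scong : proc -> proc -> Prop :=
| sc_alpha P Q : aeq P Q -> scong P Q
| sc_refl P : scong P P
| sc_sym P Q : scong P Q -> scong Q P
| sc_trans P Q R : scong P Q -> scong Q R -> scong P R
| sc_par_l P P' Q : scong P P' -> scong (PPar P Q) (PPar P' Q)
| sc_par_r P Q Q' : scong Q Q' -> scong (PPar P Q) (PPar P Q')
| sc_nu a P P' : scong P P' -> scong (PNu a P) (PNu a P')
| sc_sum l1 l2 a P P' : scong P P' ->
    scong (PSum (l1 ++ (a, P) :: l2)) (PSum (l1 ++ (a, P') :: l2))
| sc_par_comm P Q : scong (PPar P Q) (PPar Q P)
| sc_par_assoc P Q R : scong (PPar (PPar P Q) R) (PPar P (PPar Q R))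
| sc_par_unit P : scong (PPar P PNil) P
| sc_nu_par a P Q : ~ In a (fn Q) -> scong (PNu a (PPar P Q)) (PPar (PNu a P) Q)
| sc_nu_nil a : scong (PNu a PNil) PNil
| sc_nu_nu a b P : scong (PNu a (PNu b P)) (PNu b (PNu a P)).

Inductive step1 : proc -> proc -> Prop :=
| st_tau l P : In (PTau, P) l -> step1 (PSum l) P
| st_res a P P' : step1 P P' -> step1 (PNu a P) (PNu a P')
| st_par1 P P' Q : step1 P P' -> step1 (PPar P Q) (PPar P' Q)
| st_int P Q R : step2 P Q R -> step1 (PPar P Q) R
| st_str1 P Q R S : step1 P R -> scong P Q -> scong R S -> step1 Q S
with step2 : proc -> proc -> proc -> Prop :=
| st_hid a P Q R : step2 P Q R -> ~ In a (fn Q) -> step2 (PNu a P) Q (PNu a R)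
| st_par2 P Q R S : step2 P Q R -> step2 (PPar P S) Q (PPar S R)
| st_com a b y P Q l1 l2 : In (POut a b, P) l1 -> In (PIn a y, Q) l2 ->
    step2 (PSum l1) (PSum l2) (PPar P (subst1 Q b y))
| st_sym P Q R : step2 P Q R -> step2 Q P R
| st_str2 P Q R S T U : step2 P Q R -> scong P S -> scong Q T -> scong R U ->
    step2 S T U.

Definition Fobj (X : Type) : Type := (X + X * X)%type.
Definition Fmap {X Y : Type} (h : X -> Y) (x : Fobj X) : Fobj Y :=
  match x with
  | inl p => inl (h p)
  | inr (p, q) => inr (h p, h q)
  end.
Definition Bobj (X : Type) : Type := X -> Prop.
Definition Bmap {X Y : Type} (h : X -> Y) (S : Bobj X) : Bobj Y :=
  fun y => exists x, S x /\ h x = y.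

Definition dialgebra (X : Type) : Type := Fobj X -> Bobj X.

Definition is_hom {X Y : Type} (f : dialgebra X) (g : dialgebra Y) (h : X -> Y) : Prop :=
  forall (x : Fobj X) (y : Y), g (Fmap h x) y <-> Bmap h (f x) y.

Definition dial_bisim {X : Type} (f : dialgebra X) (x y : X) : Prop :=
  exists (Y : Type) (g : dialgebra Y) (h : X -> Y), is_hom f g h /\ h x = h y.

Definition pi_dialgebra : dialgebra proc :=
  fun x => match x with
           | inl P => step1 P
           | inr (P, Q) => step2 P Q
           end.

Inductive label : Type :=
| LTau : label
| LIn : name -> name -> label
| LOut : name -> name -> label
| LBOut : name -> name -> label.

Definition bn (l : label) : list name :=
  match l with LBOut _ b => [b] | _ => [] end.
Definition names (l : label) : list name :=
  match l with
  | LTau => []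
  | LIn a b | LOut a b | LBOut a b => [a; b]
  end.

Inductive lts : proc -> label -> proc -> Prop :=
| lt_tau l P : In (PTau, P) l -> lts (PSum l) LTau P
| lt_out l a b P : In (POut a b, P) l -> lts (PSum l) (LOut a b) P
| lt_in l a x b P : In (PIn a x, P) l -> lts (PSum l) (LIn a b) (subst1 P b x)
| lt_par_l P P' Q l : lts P l P' -> (forall n, In n (bn l) -> ~ In n (fn Q)) ->
    lts (PPar P Q) l (PPar P' Q)
| lt_par_r P Q Q' l : lts Q l Q' -> (forall n, In n (bn l) -> ~ In n (fn P)) ->
    lts (PPar P Q) l (PPar P Q')
| lt_com_l P P' Q Q' a b : lts P (LOut a b) P' -> lts Q (LIn a b) Q' ->
    lts (PPar P Q) LTau (PPar P' Q')
| lt_com_r P P' Q Q' a b : lts P (LIn a b) P' -> lts Q (LOut a b) Q' ->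
    lts (PPar P Q) LTau (PPar P' Q')
| lt_close_l P P' Q Q' a b : lts P (LBOut a b) P' -> lts Q (LIn a b) Q' ->
    ~ In b (fn Q) -> lts (PPar P Q) LTau (PNu b (PPar P' Q'))
| lt_close_r P P' Q Q' a b : lts P (LIn a b) P' -> lts Q (LBOut a b) Q' ->
    ~ In b (fn P) -> lts (PPar P Q) LTau (PNu b (PPar P' Q'))
| lt_res a P P' l : lts P l P' -> ~ In a (names l) -> lts (PNu a P) l (PNu a P')
| lt_open a b P P' : lts P (LOut a b) P' -> a <> b -> lts (PNu b P) (LBOut a b) P'
| lt_alpha P Q l R : aeq P Q -> lts Q l R -> lts P l R.

Definition barb_in (P : proc) (a : name) : Prop :=
  exists b P', lts P (LIn a b) P'.
Definition barb_out (P : proc) (a : name) : Prop :=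
  exists b P', lts P (LOut a b) P' \/ lts P (LBOut a b) P'.

Definition barbed_bisimulation (R : proc -> proc -> Prop) : Prop :=
  forall P Q, R P Q ->
    R Q P /\
    (forall a, barb_in P a -> barb_in Q a) /\
    (forall a, barb_out P a -> barb_out Q a) /\
    (forall P', lts P LTau P' -> exists Q', lts Q LTau Q' /\ R P' Q').

Definition barbed_bisim (P Q : proc) : Prop :=
  exists R, barbed_bisimulation R /\ R P Q.

Definition barbed_equiv (P Q : proc) : Prop :=
  forall R, barbed_bisim (PPar P R) (PPar Q R).

(* Main.v *)
(** Processes are translated to de Bruijn terms with a late labelled semantics, for which structural
    congruence is a strong bisimulation; hence the reductions of the dialgebra, its binary
    interactions and the early labelled semantics all agree up to structural congruence.

    If [h] is a homomorphism, then [{(P || R, Q || R) | h P = h Q}] is a barbed bisimulation up to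
    structural congruence: barbs of [P] are detected by interacting with a one-prefix process, and
    an interaction of [P] with [R] is a binary transition of the dialgebra.

    Conversely it suffices that barbed equivalence is preserved by both kinds of transitions, since
    then the quotient is a dialgebra.  For reductions, the finitely many candidate answers that are
    not equivalent to a given reduct are refuted by a single tester, a sum of [tau]-branches
    guarded by fresh barbs; this uses no matching.  For an interaction of [P] with [S], the process
    [S] is replaced by [a(x).S' + w(y).0], where [S'] is what remains of [S]: losing the fresh barb
    [w] forces the matching reduction to be an interaction too. *)

From Stdlib Require Import List Permutation PeanoNat Lia Classical FunctionalExtensionality PropExtensionality.
Require Import Defs.
Import ListNotations.

(** * De Bruijn terms and their late semantics *)
Inductive dpre : Type :=
| DTau : dpre
| DIn : nat -> dpre
| DOut : nat -> nat -> dpre.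

Inductive db : Type :=
| DSum : list (dpre * db) -> db
| DPar : db -> db -> db
| DNu : db -> db.

Definition DNil : db := DSum [].

Lemma db_nested_ind (P : db -> Prop) :
  (forall l, Forall (fun x => P (snd x)) l -> P (DSum l)) ->
  (forall t u, P t -> P u -> P (DPar t u)) ->
  (forall t, P t -> P (DNu t)) ->
  forall t, P t.
Proof.
  intros HS HP HN.
  fix IH 1. intros [l|t u|t].
  - apply HS. induction l as [|x l IHl]; constructor; [apply IH|exact IHl].
  - apply HP; apply IH.
  - apply HN; apply IH.
Qed.

Definition up (r : nat -> nat) (n : nat) : nat :=
  match n with 0 => 0 | S m => S (r m) end.
Definition lift (b : bool) (r : nat -> nat) : nat -> nat := if b then up r else r.
Definition pbinds (p : dpre) : bool := match p with DIn _ => true | _ => false end.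
Definition pren (r : nat -> nat) (p : dpre) : dpre :=
  match p with
  | DTau => DTau
  | DIn a => DIn (r a)
  | DOut a b => DOut (r a) (r b)
  end.

(** Names are only ever replaced by names, so [ren] with an arbitrary function covers renaming,
    weakening ([S]) and the substitution of a received name ([inst b]). *)
Fixpoint ren (r : nat -> nat) (t : db) : db :=
  match t with
  | DSum l => DSum (map (fun x => (pren r (fst x), ren (lift (pbinds (fst x)) r) (snd x))) l)
  | DPar t u => DPar (ren r t) (ren r u)
  | DNu t => DNu (ren (up r) t)
  end.

Definition inst (b n : nat) : nat := match n with 0 => b | S m => m end.
Definition swp (n : nat) : nat := match n with 0 => 1 | 1 => 0 | _ => n end.

Lemma up_comp (r s : nat -> nat) (n : nat) : up r (up s n) = up (fun k => r (s k)) n.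
Proof. now destruct n. Qed.

Lemma lift_comp b (r s : nat -> nat) :
  (fun n => lift b r (lift b s n)) = lift b (fun k => r (s k)).
Proof. destruct b; [|reflexivity]. extensionality n. apply up_comp. Qed.

Lemma ren_ren t : forall r s, ren r (ren s t) = ren (fun n => r (s n)) t.
Proof.
  induction t as [l IH|t u IHt IHu|t IHt] using db_nested_ind; intros r s; simpl.
  - f_equal. rewrite map_map. apply map_ext_in. intros [p t] Hin.
    rewrite Forall_forall in IH. specialize (IH _ Hin). simpl in *.
    destruct p; simpl; rewrite IH; do 2 f_equal; exact (lift_comp true r s).
  - now rewrite IHt, IHu.
  - rewrite IHt. do 2 f_equal. extensionality n. apply up_comp.
Qed.

Lemma lift_id b : lift b (fun n => n) = (fun n => n).
Proof. destruct b; [|reflexivity]. extensionality n. now destruct n. Qed.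

Lemma ren_id t : ren (fun n => n) t = t.
Proof.
  induction t as [l IH|t u IHt IHu|t IHt] using db_nested_ind; simpl.
  - f_equal. rewrite <- (map_id l) at 2. apply map_ext_in. intros [p t] Hin.
    rewrite Forall_forall in IH. specialize (IH _ Hin). simpl in *.
    rewrite lift_id, IH. now destruct p.
  - now rewrite IHt, IHu.
  - f_equal. rewrite <- IHt at 2. f_equal. exact (lift_id true).
Qed.

Lemma ren_pointwise t r s : (forall n, r n = s n) -> ren r t = ren s t.
Proof. intros H. f_equal. extensionality n. apply H. Qed.

Lemma ren_pointwise_id t r : (forall n, r n = n) -> ren r t = t.
Proof. intros H. rewrite <- (ren_id t) at 2. now apply ren_pointwise. Qed.

Ltac cases_nat :=
  let n := fresh "n" in
  intros n; simpl; repeat (destruct n as [|n]; simpl; try reflexivity).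
Ltac solve_ren :=
  simpl; rewrite ?ren_ren; simpl;
  first [ reflexivity
        | apply ren_pointwise; cases_nat
        | apply ren_pointwise_id; cases_nat
        | symmetry; apply ren_pointwise_id; cases_nat
        | f_equal; solve_ren ].

(** * Structural congruence of de Bruijn terms *)

(** Alpha-conversion is the identity in this representation, and the side condition of scope
    extrusion becomes the weakening [ren S u]. Reordering of sums remains an explicit rule. *)
Inductive dcong : db -> db -> Prop :=
| dcong_refl t : dcong t t
| dcong_sym t u : dcong t u -> dcong u t
| dcong_trans t u v : dcong t u -> dcong u v -> dcong t v
| dcong_par_l t t' u : dcong t t' -> dcong (DPar t u) (DPar t' u)
| dcong_nu t t' : dcong t t' -> dcong (DNu t) (DNu t')
| dcong_sum l1 l2 p t t' : dcong t t' ->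
    dcong (DSum (l1 ++ (p, t) :: l2)) (DSum (l1 ++ (p, t') :: l2))
| dcong_perm l l' : Permutation l l' -> dcong (DSum l) (DSum l')
| dcong_comm t u : dcong (DPar t u) (DPar u t)
| dcong_assoc t u v : dcong (DPar (DPar t u) v) (DPar t (DPar u v))
| dcong_unit t : dcong (DPar t DNil) t
| dcong_nu_par t u : dcong (DNu (DPar t (ren S u))) (DPar (DNu t) u)
| dcong_nu_nil : dcong (DNu DNil) DNil
| dcong_nu_nu t : dcong (DNu (DNu t)) (DNu (DNu (ren swp t))).

#[local] Hint Resolve dcong_refl dcong_par_l dcong_nu dcong_comm dcong_assoc dcong_unit dcong_nu_par : dcong.
#[local] Hint Immediate dcong_sym : dcong.

Lemma dcong_par_r t u u' : dcong u u' -> dcong (DPar t u) (DPar t u').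
Proof. eauto using dcong. Qed.
#[local] Hint Resolve dcong_par_r : dcong.

Lemma dcong_par t t' u u' : dcong t t' -> dcong u u' -> dcong (DPar t u) (DPar t' u').
Proof. intros Ht Hu. eapply dcong_trans; [apply dcong_par_l, Ht|apply dcong_par_r, Hu]. Qed.
#[local] Hint Resolve dcong_par : dcong.

Lemma dcong_nu_par_r t u : dcong (DNu (DPar (ren S u) t)) (DPar u (DNu t)).
Proof.
  eapply dcong_trans; [apply dcong_nu, dcong_comm|]. eapply dcong_trans; [apply dcong_nu_par|]. auto with dcong.
Qed.

Lemma dcong_ren t u : dcong t u -> forall r, dcong (ren r t) (ren r u).
Proof.
  induction 1; intros r; simpl.
  - apply dcong_refl.
  - apply dcong_sym; auto.
  - eapply dcong_trans; eauto.
  - auto with dcong.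
  - auto with dcong.
  - rewrite !map_app; simpl. now apply dcong_sum.
  - now apply dcong_perm, Permutation_map.
  - apply dcong_comm.
  - apply dcong_assoc.
  - apply dcong_unit.
  - replace (ren (up r) (ren S u)) with (ren S (ren r u)) by solve_ren. apply dcong_nu_par.
  - apply dcong_nu_nil.
  - replace (ren (up (up r)) (ren swp t)) with (ren swp (ren (up (up r)) t)) by solve_ren.
    apply dcong_nu_nu.
Qed.
#[local] Hint Resolve dcong_ren : dcong.

(** Labels are late: an input records its channel only, so prefixes double as labels; [Bout] adds
    bound output. *)
Inductive lab : Type :=
| Act : dpre -> lab
| Bout : nat -> lab.

Definition binds (l : lab) : bool := match l with Act p => pbinds p | Bout _ => true end.
Definition lren (r : nat -> nat) (l : lab) : lab :=
  match l with Act p => Act (pren r p) | Bout a => Bout (r a) end.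
Definition shift (b : bool) (t : db) : db := if b then ren S t else t.
(** In the residual of a binding label below a restriction, index 0 is the name bound by the label
    and index 1 the restricted one; the restriction put back around it must capture the latter. *)
Definition exch (b : bool) (t : db) : db := if b then ren swp t else t.

(* The residual of an input or of a bound output lives under one more binder, index 0 being the
   received or extruded name. *)
Inductive tr : db -> lab -> db -> Prop :=
| tr_act l p t : In (p, t) l -> tr (DSum l) (Act p) t
| tr_par_l t l t' u : tr t l t' -> tr (DPar t u) l (DPar t' (shift (binds l) u))
| tr_par_r t l u u' : tr u l u' -> tr (DPar t u) l (DPar (shift (binds l) t) u')
| tr_com_l a b t t' u u' : tr t (Act (DOut a b)) t' -> tr u (Act (DIn a)) u' ->
    tr (DPar t u) (Act DTau) (DPar t' (ren (inst b) u'))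
| tr_com_r a b t t' u u' : tr t (Act (DIn a)) t' -> tr u (Act (DOut a b)) u' ->
    tr (DPar t u) (Act DTau) (DPar (ren (inst b) t') u')
| tr_close_l a t t' u u' : tr t (Bout a) t' -> tr u (Act (DIn a)) u' ->
    tr (DPar t u) (Act DTau) (DNu (DPar t' u'))
| tr_close_r a t t' u u' : tr t (Act (DIn a)) t' -> tr u (Bout a) u' ->
    tr (DPar t u) (Act DTau) (DNu (DPar t' u'))
| tr_res t l t' : tr t (lren S l) t' -> tr (DNu t) l (DNu (exch (binds l) t'))
| tr_open a t t' : tr t (Act (DOut (S a) 0)) t' -> tr (DNu t) (Bout a) t'.

Lemma binds_lren r l : binds (lren r l) = binds l.
Proof. now destruct l as [[]|]. Qed.

Lemma lren_comp r s l : lren r (lren s l) = lren (fun n => r (s n)) l.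
Proof. now destruct l as [[]|]. Qed.

Definition inj (r : nat -> nat) : Prop := forall m n, r m = r n -> m = n.

Lemma inj_up r : inj r -> inj (up r).
Proof. intros H [|m] [|n] E; simpl in E; try discriminate; auto. Qed.

Lemma inj_S : inj S.
Proof. intros m n E. now injection E. Qed.

(** Holds for every [r], injective or not: without matching, identifying names never disables a
    transition. *)
Lemma tr_ren t l t' : tr t l t' -> forall r, tr (ren r t) (lren r l) (ren (lift (binds l) r) t').
Proof.
  induction 1; intros r; simpl in *.
  - apply tr_act. apply in_map_iff. exists (p, t). auto.
  - replace (ren (lift (binds l) r) (shift (binds l) u)) with (shift (binds (lren r l)) (ren r u)).
    + now apply tr_par_l.
    + rewrite binds_lren. destruct (binds l); solve_ren.
  - replace (ren (lift (binds l) r) (shift (binds l) t)) with (shift (binds (lren r l)) (ren r t)).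
    + now apply tr_par_r.
    + rewrite binds_lren. destruct (binds l); solve_ren.
  - replace (ren r (ren (inst b) u')) with (ren (inst (r b)) (ren (up r) u')) by solve_ren.
    eapply tr_com_l; [apply IHtr1|apply IHtr2].
  - replace (ren r (ren (inst b) t')) with (ren (inst (r b)) (ren (up r) t')) by solve_ren.
    eapply tr_com_r; [apply IHtr1|apply IHtr2].
  - eapply tr_close_l; [apply IHtr1|apply IHtr2].
  - eapply tr_close_r; [apply IHtr1|apply IHtr2].
  - specialize (IHtr (up r)). rewrite binds_lren, lren_comp in IHtr. simpl in IHtr.
    rewrite <- (lren_comp S r) in IHtr. apply tr_res in IHtr. rewrite binds_lren in IHtr.
    destruct (binds l); simpl in *; [|exact IHtr].
    replace (ren (up (up r)) (ren swp t')) with (ren swp (ren (up (up r)) t')) by solve_ren.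
    exact IHtr.
  - apply tr_open. apply (IHtr (up r)).
Qed.

(** Serves the restriction case of the inversion below: if a renaming by [up r] yields a label that
    avoids index 0, the original label avoided it already. *)
Lemma lren_up_S r l l0 : lren S l = lren (up r) l0 -> exists l1, l0 = lren S l1 /\ l = lren r l1.
Proof.
  destruct l as [[|a|a b]|a], l0 as [[|c|c d]|c]; simpl; intros E; try discriminate;
    try (injection E; intros); try (destruct c; [discriminate|]); try (destruct d; [discriminate|]);
    simpl in *.
  - now exists (Act DTau).
  - exists (Act (DIn c)). simpl. split; congruence.
  - exists (Act (DOut c d)). simpl. split; congruence.
  - exists (Bout c). simpl. split; congruence.
Qed.

Ltac inv H := inversion H; subst; clear H.

(** Injectivity is essential: merging two channels could enable a communication that [u] itself
    cannot perform. *)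
Lemma tr_ren_inv t l t' : tr t l t' -> forall r u, inj r -> t = ren r u ->
  exists l0 u', tr u l0 u' /\ l = lren r l0 /\ t' = ren (lift (binds l0) r) u'.
Proof.
  induction 1; intros r v Hr E; destruct v as [m|v1 v2|v1]; simpl in E; try discriminate;
    injection E; intros; subst; clear E.
  - apply in_map_iff in H as ([q v]&E&Hin). simpl in E. injection E; intros; subst.
    exists (Act q), v. repeat split. now apply tr_act.
  - destruct (IHtr r v1 Hr eq_refl) as (l0&u'&Ht&->&->).
    exists l0, (DPar u' (shift (binds l0) v2)). repeat split; [now apply tr_par_l|].
    rewrite binds_lren. simpl. destruct (binds l0); solve_ren.
  - destruct (IHtr r v2 Hr eq_refl) as (l0&u0&Ht&->&->).
    exists l0, (DPar (shift (binds l0) v1) u0). repeat split; [now apply tr_par_r|].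
    rewrite binds_lren. simpl. destruct (binds l0); solve_ren.
  - destruct (IHtr1 r v1 Hr eq_refl) as ([[]|]&t0&Ht&E1&->); simpl in E1; try discriminate.
    destruct (IHtr2 r v2 Hr eq_refl) as ([[]|]&u0&Hu&E2&->); simpl in E2; try discriminate.
    injection E1; intros -> ->. injection E2; intros Ea. apply Hr in Ea; subst.
    exists (Act DTau). eexists. repeat split; [eapply tr_com_l; eauto|]. solve_ren.
  - destruct (IHtr1 r v1 Hr eq_refl) as ([[]|]&t0&Ht&E1&->); simpl in E1; try discriminate.
    destruct (IHtr2 r v2 Hr eq_refl) as ([[]|]&u0&Hu&E2&->); simpl in E2; try discriminate.
    injection E1; intros ->. injection E2; intros -> Ea. apply Hr in Ea; subst.
    exists (Act DTau). eexists. repeat split; [eapply tr_com_r; eauto|]. solve_ren.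
  - destruct (IHtr1 r v1 Hr eq_refl) as ([[]|]&t0&Ht&E1&->); simpl in E1; try discriminate.
    destruct (IHtr2 r v2 Hr eq_refl) as ([[]|]&u0&Hu&E2&->); simpl in E2; try discriminate.
    injection E1; intros ->. injection E2; intros Ea. apply Hr in Ea; subst.
    exists (Act DTau). eexists. split; [eapply tr_close_l; eauto|]. split; reflexivity.
  - destruct (IHtr1 r v1 Hr eq_refl) as ([[]|]&t0&Ht&E1&->); simpl in E1; try discriminate.
    destruct (IHtr2 r v2 Hr eq_refl) as ([[]|]&u0&Hu&E2&->); simpl in E2; try discriminate.
    injection E1; intros ->. injection E2; intros Ea. apply Hr in Ea; subst.
    exists (Act DTau). eexists. split; [eapply tr_close_r; eauto|]. split; reflexivity.
  - destruct (IHtr (up r) v1 (inj_up _ Hr) eq_refl) as (l0&u'&Ht&E&->).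
    apply lren_up_S in E as (l1&->&->).
    exists l1. eexists. repeat split; [apply tr_res; eauto|].
    rewrite !binds_lren. simpl. destruct (binds l1); solve_ren.
  - destruct (IHtr (up r) v1 (inj_up _ Hr) eq_refl) as ([[]|]&u'&Ht&E&->); simpl in E; try discriminate.
    injection E; intros E0 Ea. destruct n0; [|discriminate]. destruct n; [discriminate|].
    injection Ea; intros ->. exists (Bout n), u'. repeat split. now apply tr_open.
Qed.

(** * Structural congruence is a strong bisimulation *)

(** Residuals are compared by [dcong] itself, so this is a one-step property; once it holds in both
    directions for every rule of [dcong], that relation is a bisimulation. *)
Definition sim (t u : db) : Prop :=
  forall l t', tr t l t' -> exists u', tr u l u' /\ dcong t' u'.

Lemma sim_trans t u v : sim t u -> sim u v -> sim t v.
Proof.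
  intros H1 H2 l t' Ht. destruct (H1 _ _ Ht) as (u'&Hu&?), (H2 _ _ Hu) as (v'&Hv&?).
  exists v'. eauto using dcong_trans.
Qed.

Lemma dcong_shift b t u : dcong t u -> dcong (shift b t) (shift b u).
Proof. destruct b; simpl; auto with dcong. Qed.
Lemma dcong_exch b t u : dcong t u -> dcong (exch b t) (exch b u).
Proof. destruct b; simpl; auto with dcong. Qed.
#[local] Hint Resolve dcong_shift dcong_exch : dcong.
#[local] Hint Constructors tr : tr.

Lemma sim_comm t u : sim (DPar t u) (DPar u t).
Proof. intros l t' H. inv H; eexists; split; eauto with tr dcong. Qed.

(** The congruence hypothesis serves the moves of [u] alone, whose residuals still contain [t] and
    [t'] up to weakening. *)
Lemma sim_par_l t t' u : dcong t t' -> sim t t' -> sim (DPar t u) (DPar t' u).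
Proof.
  intros Hd Hs l v H. inv H;
    try (match goal with Ht : tr t _ _ |- _ => destruct (Hs _ _ Ht) as (?&?&?) end);
    eexists; split; eauto with tr dcong.
Qed.

Lemma sim_nu t t' : sim t t' -> sim (DNu t) (DNu t').
Proof.
  intros Hs l v H. inv H;
    match goal with Ht : tr t _ _ |- _ => destruct (Hs _ _ Ht) as (?&?&?) end;
    eexists; split; eauto with tr dcong.
Qed.

Lemma tr_sum_inv l a t : tr (DSum l) a t -> exists p, a = Act p /\ In (p, t) l.
Proof. intros H. inv H. eauto. Qed.

Lemma sim_sum l1 l2 p t t' : dcong t t' ->
  sim (DSum (l1 ++ (p, t) :: l2)) (DSum (l1 ++ (p, t') :: l2)).
Proof.
  intros Hd l v H. apply tr_sum_inv in H as (q&->&H). apply in_app_iff in H as [Hi|[Hi|Hi]].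
  - exists v. split; [apply tr_act, in_app_iff|]; auto with dcong.
  - injection Hi; intros; subst.
    exists t'. split; [apply tr_act, in_app_iff; simpl|]; auto.
  - exists v. split; [apply tr_act, in_app_iff; simpl|]; auto with dcong.
Qed.

Lemma sim_perm l l' : Permutation l l' -> sim (DSum l) (DSum l').
Proof.
  intros Hp a v H. apply tr_sum_inv in H as (p&->&H). exists v. split; [|apply dcong_refl].
  apply tr_act. eapply Permutation_in; eauto.
Qed.

Lemma no_tr_nil l t : ~ tr DNil l t.
Proof. intros H. inv H. contradiction. Qed.

Lemma sim_unit t : sim (DPar t DNil) t.
Proof.
  intros l v H. inv H; try (exfalso; eapply no_tr_nil; eassumption).
  eexists; split; [eassumption|]. destruct (binds l); apply dcong_unit.
Qed.

Lemma sim_unit_inv t : sim t (DPar t DNil).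
Proof.
  intros l v H. eexists. split; [apply tr_par_l; eassumption|].
  apply dcong_sym. destruct (binds l); apply dcong_unit.
Qed.

Lemma shift_par b t u : shift b (DPar t u) = DPar (shift b t) (shift b u).
Proof. now destruct b. Qed.

Lemma inst_shift b t : ren (inst b) (ren S t) = t.
Proof. solve_ren. Qed.

Lemma sim_assoc t u v : sim (DPar (DPar t u) v) (DPar t (DPar u v)).
Proof.
  (* When a bound output is closed, the new restriction spans two components on one side and three
     on the other; these two equations absorb the idle component. *)
  assert (Hnu : forall x y z, dcong (DPar (DNu (DPar x y)) z) (DNu (DPar x (DPar y (ren S z))))).
  { intros x y z. eapply dcong_trans; [apply dcong_sym, dcong_nu_par|]. apply dcong_nu, dcong_assoc. }
  assert (Hnu' : forall x y z, dcong (DNu (DPar (DPar (ren S x) y) z)) (DPar x (DNu (DPar y z)))).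
  { intros x y z. eapply dcong_trans; [apply dcong_nu, dcong_assoc|]. apply dcong_nu_par_r. }
  intros l w H. inv H;
    try match goal with H : tr (DPar _ _) _ _ |- _ => inv H end; rewrite ?shift_par; simpl in *;
    rewrite ?inst_shift;
    try (eexists; split; [eauto with tr|rewrite ?shift_par; simpl; eauto with dcong]; fail).
  (* The free name sent by [t] instantiates the whole residual of [DPar u v], so the weakening of
     the idle component has to be cancelled by [inst_shift]. *)
  - eexists; split; [eapply tr_com_l; [eassumption|eapply tr_par_l; eassumption]|].
    simpl. rewrite inst_shift. apply dcong_assoc.
  - eexists; split; [eapply tr_com_l; [eassumption|eapply tr_par_r; eassumption]|].
    simpl. rewrite inst_shift. apply dcong_assoc.
Qed.

Lemma sim_assoc_inv t u v : sim (DPar t (DPar u v)) (DPar (DPar t u) v).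
Proof.
  eapply sim_trans; [apply sim_comm|]. eapply sim_trans; [apply sim_assoc|].
  eapply sim_trans; [apply sim_comm|]. eapply sim_trans; [apply sim_assoc|]. apply sim_comm.
Qed.

Lemma sim_nu_nil : sim (DNu DNil) DNil.
Proof. intros l v H. inv H; exfalso; eapply no_tr_nil; eassumption. Qed.

Lemma swp_swp t : ren swp (ren swp t) = t.
Proof. solve_ren. Qed.

Lemma sim_nu_nu t : sim (DNu (DNu t)) (DNu (DNu (ren swp t))).
Proof.
  intros l v H. inv H.
  - remember (lren S l) as l1 eqn:El. inv H1.
    + apply (tr_ren _ _ _) with (r := swp) in H0.
      rewrite binds_lren.
      (* The indices of a doubly weakened label are at least 2, out of reach of [swp]. *)
      replace (lren swp (lren S (lren S l))) with (lren S (lren S l)) in H0 by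
        now destruct l as [[]|].
      apply tr_res in H0. apply tr_res in H0. rewrite !binds_lren in H0.
      eexists; split; [exact H0|].
      destruct (binds l); simpl; [|apply dcong_nu_nu].
      eapply dcong_trans; [apply dcong_nu_nu|].
      match goal with |- dcong ?a ?b => replace b with a; [apply dcong_refl|] end.
      solve_ren.
    (* The inner restriction is opened here. After the swap it is the outer one, so opening and
       passing a restriction change places. *)
    + destruct l as [[]|]; try discriminate. injection H2 as ->.
      apply (tr_ren _ _ _) with (r := swp) in H0. simpl in H0.
      eexists; split; [apply tr_open, (tr_res _ (Act (DOut (S n) 0))), H0|]. apply dcong_refl.
  - inv H1. apply (tr_ren _ _ _) with (r := swp) in H0. simpl in H0.
    eexists; split; [apply (tr_res _ (Bout a)), tr_open, H0|].
    simpl. rewrite swp_swp. apply dcong_refl.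
Qed.

Lemma sim_nu_nu_inv t : sim (DNu (DNu (ren swp t))) (DNu (DNu t)).
Proof. rewrite <- (swp_swp t) at 2. apply sim_nu_nu. Qed.

Lemma tr_shift_inv u l u' : tr (ren S u) l u' ->
  exists l0 u0, tr u l0 u0 /\ l = lren S l0 /\ u' = ren (lift (binds l0) S) u0.
Proof. intros H. exact (tr_ren_inv _ _ _ H S u inj_S eq_refl). Qed.

Ltac shift_inv :=
  match goal with
  | H : tr (ren S _) _ _ |- _ =>
      let l := fresh "l" in let E := fresh "E" in
      apply tr_shift_inv in H as (l&?&?&E&->);
      destruct l as [[]|]; try discriminate E; injection E as E; subst
  end.

Lemma lren_S_inj l l' : lren S l = lren S l' -> l = l'.
Proof. destruct l as [[]|], l' as [[]|]; simpl; intros E; congruence. Qed.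

Lemma dcong_of_eq t u : t = u -> dcong t u.
Proof. intros ->. apply dcong_refl. Qed.

(** The de Bruijn counterpart of [step2]: the silent moves of a parallel composition in which both
    components take part. *)
Inductive com : db -> db -> db -> Prop :=
| com_com_l a b t t' u u' : tr t (Act (DOut a b)) t' -> tr u (Act (DIn a)) u' ->
    com t u (DPar t' (ren (inst b) u'))
| com_com_r a b t t' u u' : tr t (Act (DIn a)) t' -> tr u (Act (DOut a b)) u' ->
    com t u (DPar (ren (inst b) t') u')
| com_close_l a t t' u u' : tr t (Bout a) t' -> tr u (Act (DIn a)) u' ->
    com t u (DNu (DPar t' u'))
| com_close_r a t t' u u' : tr t (Act (DIn a)) t' -> tr u (Bout a) u' ->
    com t u (DNu (DPar t' u')).

Lemma com_tr t u v : com t u v -> tr (DPar t u) (Act DTau) v.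
Proof.
  destruct 1; [eapply tr_com_l|eapply tr_com_r|eapply tr_close_l|eapply tr_close_r]; eassumption.
Qed.

Lemma tr_par_inv t u l v : tr (DPar t u) l v ->
  (exists t', tr t l t' /\ v = DPar t' (shift (binds l) u)) \/
  (exists u', tr u l u' /\ v = DPar (shift (binds l) t) u') \/
  (l = Act DTau /\ com t u v).
Proof. intros H. inv H; eauto 6 using com. Qed.

Lemma tr_par_tau t u v : tr (DPar t u) (Act DTau) v ->
  (exists t', tr t (Act DTau) t' /\ v = DPar t' u) \/
  (exists u', tr u (Act DTau) u' /\ v = DPar t u') \/ com t u v.
Proof. intros H. apply tr_par_inv in H. tauto. Qed.

(** Mirrors [st_hid]: the weakening [ren S u] expresses that the restricted name is not free in
    [u]. *)
Lemma com_nu t u v : com t (ren S u) v -> exists v', com (DNu t) u v' /\ dcong v' (DNu v).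
Proof.
  intros H. inv H; shift_inv.
  (* If the name sent is the restricted one, index 0, the restriction opens and the communication
     becomes a close. *)
  - destruct b as [|b].
    + eexists; split; [eapply com_close_l; [apply tr_open; eassumption|eassumption]|].
      apply dcong_of_eq. simpl. do 2 f_equal. solve_ren.
    + eexists; split; [eapply com_com_l; [apply (tr_res _ (Act (DOut _ _))); eassumption|eassumption]|].
      apply dcong_sym. simpl.
      replace (ren (inst (S b)) (ren (up S) x)) with (ren S (ren (inst b) x)) by solve_ren.
      apply dcong_nu_par.
  - eexists; split; [eapply com_com_r; [apply (tr_res _ (Act (DIn _))); eassumption|eassumption]|].
    apply dcong_sym. simpl. eapply dcong_trans; [apply dcong_nu_par|]. apply dcong_par_l, dcong_nu, dcong_of_eq. solve_ren.
  - eexists; split; [eapply com_close_l; [apply (tr_res _ (Bout _)); eassumption|eassumption]|].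
    apply dcong_sym. simpl. eapply dcong_trans; [apply dcong_nu_nu|].
    eapply dcong_trans; [|apply dcong_nu, dcong_nu_par]. apply dcong_of_eq. simpl. do 3 f_equal. solve_ren.
  - eexists; split; [eapply com_close_r; [apply (tr_res _ (Act (DIn _))); eassumption|eassumption]|].
    apply dcong_sym. simpl. eapply dcong_trans; [apply dcong_nu_nu|].
    eapply dcong_trans; [|apply dcong_nu, dcong_nu_par]. apply dcong_of_eq. simpl. do 3 f_equal. solve_ren.
Qed.

Lemma sim_nu_par t u : sim (DNu (DPar t (ren S u))) (DPar (DNu t) u).
Proof.
  intros l v H. inv H.
  - match goal with H : tr (DPar _ _) _ _ |- _ =>
      apply tr_par_inv in H as [(t0&Ht&->)|[(u0&Hu&->)|[E Hc]]] end.
    + eexists; split; [apply tr_par_l, tr_res; eassumption|]. rewrite binds_lren.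
      destruct (binds l); simpl; [|apply dcong_nu_par].
      replace (ren swp (ren S (ren S u))) with (ren S (ren S u)) by solve_ren. apply dcong_nu_par.
    + apply tr_shift_inv in Hu as (l0&u1&Hu&E&->). apply lren_S_inj in E as <-.
      eexists; split; [apply tr_par_r; eassumption|]. rewrite binds_lren.
      destruct (binds l); simpl; [|apply dcong_nu_par].
      replace (ren swp (ren S t)) with (ren (up S) t) by solve_ren.
      replace (ren swp (ren (up S) u1)) with (ren S u1) by solve_ren. apply dcong_nu_par.
    + destruct l as [[]|]; try discriminate. apply com_nu in Hc as (v&Hv&Hd).
      exists v. split; [now apply com_tr|now apply dcong_sym].
  - match goal with H : tr (DPar _ _) _ _ |- _ => inv H end.
    + eexists; split; [apply tr_par_l, tr_open; eassumption|]. apply dcong_refl.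
    (* The opened name would have to be sent by the weakened component, which does not contain
       it. *)
    + shift_inv.
Qed.

Ltac inv_nu := match goal with H : tr (DNu _) _ _ |- _ => inv H end.
Ltac shift_tr u := match goal with H : tr u _ _ |- _ => apply (tr_ren _ _ _) with (r := S) in H end.

Lemma sim_nu_par_inv t u : sim (DPar (DNu t) u) (DNu (DPar t (ren S u))).
Proof.
  intros l v H. inv H.
  - inv_nu.
    + eexists; split; [apply tr_res, tr_par_l; eassumption|]. apply dcong_sym. rewrite binds_lren.
      destruct (binds l); simpl; [|apply dcong_nu_par].
      replace (ren swp (ren S (ren S u))) with (ren S (ren S u)) by solve_ren. apply dcong_nu_par.
    + eexists; split; [apply tr_open, (tr_par_l _ (Act _)); eassumption|]. apply dcong_refl.
  - shift_tr u.
    eexists; split; [apply tr_res, tr_par_r; eassumption|]. apply dcong_sym. rewrite binds_lren.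
    destruct (binds l); simpl; [|apply dcong_nu_par].
    replace (ren swp (ren S t)) with (ren (up S) t) by solve_ren.
    replace (ren swp (ren (up S) u')) with (ren S u') by solve_ren. apply dcong_nu_par.
  - inv_nu. shift_tr u.
    eexists; split; [apply (tr_res _ (Act DTau)); eapply tr_com_l; eassumption|]. apply dcong_sym. simpl.
    replace (ren (inst (S b)) (ren (up S) u')) with (ren S (ren (inst b) u')) by solve_ren.
    apply dcong_nu_par.
  - inv_nu. shift_tr u.
    eexists; split; [apply (tr_res _ (Act DTau)); eapply tr_com_r; eassumption|]. apply dcong_sym. simpl.
    eapply dcong_trans; [apply dcong_nu_par|]. apply dcong_par_l, dcong_nu, dcong_of_eq. solve_ren.
  - shift_tr u. inv_nu.
    + eexists; split; [apply (tr_res _ (Act DTau)); eapply tr_close_l; eassumption|]. apply dcong_sym. simpl.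
      eapply dcong_trans; [apply dcong_nu_nu|].
      eapply dcong_trans; [|apply dcong_nu, dcong_nu_par]. apply dcong_of_eq. simpl. do 3 f_equal. solve_ren.
    (* The bound output came from opening this very restriction; beneath it the interaction is a
       plain communication of index 0. *)
    + eexists; split; [apply (tr_res _ (Act DTau)); eapply tr_com_l; eassumption|].
      apply dcong_of_eq. simpl. do 2 f_equal. solve_ren.
  - shift_tr u. inv_nu.
    eexists; split; [apply (tr_res _ (Act DTau)); eapply tr_close_r; eassumption|]. apply dcong_sym. simpl.
    eapply dcong_trans; [apply dcong_nu_nu|].
    eapply dcong_trans; [|apply dcong_nu, dcong_nu_par]. apply dcong_of_eq. simpl. do 3 f_equal. solve_ren.
Qed.

(** Both directions are proved together because of the symmetry rule. *)
Lemma dcong_sims t u : dcong t u -> sim t u /\ sim u t.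
Proof.
  induction 1.
  - split; intros l v Hv; exists v; auto with dcong.
  - tauto.
  - split; eapply sim_trans; intuition eauto.
  - split; apply sim_par_l; intuition auto with dcong.
  - split; apply sim_nu; tauto.
  - split; apply sim_sum; auto with dcong.
  - split; apply sim_perm; auto. now apply Permutation_sym.
  - split; apply sim_comm.
  - split; [apply sim_assoc|apply sim_assoc_inv].
  - split; [apply sim_unit|apply sim_unit_inv].
  - split; [apply sim_nu_par|apply sim_nu_par_inv].
  - split; [apply sim_nu_nil|]. intros l v Hv. exfalso; eapply no_tr_nil; eassumption.
  - split; [apply sim_nu_nu|apply sim_nu_nu_inv].
Qed.

Lemma dcong_tr t u l t' : dcong t u -> tr t l t' -> exists u', tr u l u' /\ dcong t' u'.
Proof. intros H. apply (proj1 (dcong_sims _ _ H)). Qed.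

(** * Translation of processes *)

Lemma proc_nested_ind (H : proc -> Prop) :
  (forall l, Forall (fun x => H (snd x)) l -> H (PSum l)) ->
  (forall P Q, H P -> H Q -> H (PPar P Q)) ->
  (forall a P, H P -> H (PNu a P)) ->
  forall P, H P.
Proof.
  intros HS HP HN.
  fix IH 1. intros [l|P Q|a P].
  - apply HS. induction l as [|x l IHl]; constructor; [apply IH|exact IHl].
  - apply HP; apply IH.
  - apply HN; apply IH.
Qed.

Lemma in_rem n x l : In n (rem x l) <-> In n l /\ n <> x.
Proof.
  unfold rem. rewrite filter_In. destruct (Nat.eqb_spec n x); simpl; intuition congruence.
Qed.

Lemma in_lt_fresh n L : In n L -> n < fresh L.
Proof.
  intros H. unfold fresh. pose proof (proj1 (list_max_le L (list_max L)) (le_n _)) as F.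
  rewrite Forall_forall in F. specialize (F _ H). lia.
Qed.

Lemma fresh_not_in L : ~ In (fresh L) L.
Proof. intros H. apply in_lt_fresh in H. lia. Qed.

Lemma in_fn_sum n l :
  In n (fn (PSum l)) <-> exists p Q, In (p, Q) l /\ In n (fn_pre p (fn Q)).
Proof.
  induction l as [|[p Q] l IH]; simpl.
  - firstorder.
  - simpl in IH. rewrite in_app_iff, IH. split.
    + intros [H|(q&R&H&H')]; [exists p, Q|exists q, R]; auto.
    + intros (q&R&[E|H]&H'); [injection E as -> ->; auto|right; eauto].
Qed.

Definition subst_branch (s : name -> name) (x : prefix * proc) : prefix * proc :=
  match fst x with
  | PTau => (PTau, subst s (snd x))
  | POut a b => (POut (s a) (s b), subst s (snd x))
  | PIn a y =>
      let z := fresh (map s (rem y (fn (snd x)))) in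
      (PIn (s a) z, subst (upd s y z) (snd x))
  end.

Lemma subst_sum s l : subst s (PSum l) = PSum (map (subst_branch s) l).
Proof.
  simpl. f_equal. induction l as [|[[] Q] l IH]; simpl; [reflexivity|..]; now rewrite IH.
Qed.

Lemma upd_same s x z : upd s x z x = z.
Proof. unfold upd. now rewrite Nat.eqb_refl. Qed.

Lemma upd_other s x z n : n <> x -> upd s x z n = s n.
Proof. unfold upd. intros H. now apply Nat.eqb_neq in H as ->. Qed.

Lemma in_fn_subst P : forall s n, In n (fn (subst s P)) -> exists m, In m (fn P) /\ s m = n.
Proof.
  assert (Hb : forall s x z L n m, In m L -> upd s x z m = n -> n <> z ->
    exists m, In m (rem x L) /\ s m = n).
  { intros s x z L n m Hm E Hn. exists m. rewrite in_rem.
    destruct (Nat.eq_dec m x) as [->|Hmx].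
    - rewrite upd_same in E. congruence.
    - rewrite upd_other in E; auto. }
  induction P as [l IH|P Q IHP IHQ|a P IHP] using proc_nested_ind; intros s n H.
  - rewrite subst_sum in H. apply in_fn_sum in H as (p'&Q'&Hin&H).
    apply in_map_iff in Hin as ([p Q]&E&Hin).
    rewrite Forall_forall in IH. specialize (IH _ Hin). simpl in IH.
    cut (exists m, In m (fn_pre p (fn Q)) /\ s m = n).
    { intros (m&Hm&<-). exists m. rewrite in_fn_sum. eauto. }
    destruct p as [|a x|a b]; cbn in E; injection E as <- <-; simpl in H |- *.
    + eauto.
    + destruct H as [<-|H]; [eauto|]. apply in_rem in H as [H Hne].
      apply IH in H as (m&Hm&E).
      destruct (Hb _ _ _ _ _ _ Hm E Hne) as (k&?&?). eauto.
    + destruct H as [<-|[<-|H]]; [eauto|eauto|]. apply IH in H as (m&?&?). eauto.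
  - simpl in *. apply in_app_iff in H as [H|H]; [apply IHP in H|apply IHQ in H];
      destruct H as (m&?&?); exists m; rewrite in_app_iff; auto.
  - simpl in *. apply in_rem in H as [H Hne]. apply IHP in H as (m&Hm&E).
    exact (Hb _ _ _ _ _ _ Hm E Hne).
Qed.

Definition env (a : name) (r : name -> nat) : name -> nat := upd (fun n => S (r n)) a 0.

Definition pre_env (p : prefix) (r : name -> nat) : name -> nat :=
  match p with PIn _ x => env x r | _ => r end.

Definition enc_pre (r : name -> nat) (p : prefix) : dpre :=
  match p with
  | PTau => DTau
  | PIn a _ => DIn (r a)
  | POut a b => DOut (r a) (r b)
  end.

(* [enc r P] represents the free name [n] of [P] by the index [r n]. *)
Fixpoint enc (r : name -> nat) (P : proc) : db :=
  match P with
  | PSum l => DSum (map (fun x => (enc_pre r (fst x), enc (pre_env (fst x) r) (snd x))) l)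
  | PPar P Q => DPar (enc r P) (enc r Q)
  | PNu a P => DNu (enc (env a r) P)
  end.

Lemma env_same a r : env a r a = 0.
Proof. exact (upd_same _ a 0). Qed.

Lemma env_other a r n : n <> a -> env a r n = S (r n).
Proof. exact (upd_other _ a 0 n). Qed.

Lemma env_ext a r r' L : (forall n, In n (rem a L) -> r n = r' n) ->
  forall n, In n L -> env a r n = env a r' n.
Proof.
  intros H n Hn. destruct (Nat.eq_dec n a) as [->|Hna].
  - now rewrite !env_same.
  - rewrite !env_other by auto. f_equal. apply H, in_rem; auto.
Qed.

Lemma enc_ext P : forall r r', (forall n, In n (fn P) -> r n = r' n) -> enc r P = enc r' P.
Proof.
  induction P as [l IH|P Q IHP IHQ|a P IHP] using proc_nested_ind; intros r r' H.
  - simpl. f_equal. apply map_ext_in. intros [p Q] Hin.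
    rewrite Forall_forall in IH. specialize (IH _ Hin). simpl in *.
    assert (H' : forall n, In n (fn_pre p (fn Q)) -> r n = r' n).
    { intros n Hn. apply H. apply (in_fn_sum n l). eauto. }
    destruct p as [|a x|a b]; simpl in *.
    + f_equal; auto.
    + rewrite (H' a) by auto. f_equal. apply IH, env_ext. auto.
    + rewrite (H' a), (H' b) by auto. f_equal; auto.
  - simpl in *. f_equal; [apply IHP|apply IHQ]; intros; apply H, in_app_iff; auto.
  - simpl in *. f_equal. apply IHP, env_ext. auto.
Qed.

(** This is where capture avoidance enters: [z] differs from the image of every other free name, so
    only [a] is sent to index 0. *)
Lemma env_upd_fresh a z s r L : ~ In z (map s (rem a L)) ->
  forall n, In n L -> env z r (upd s a z n) = env a (fun k => r (s k)) n.
Proof.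
  intros Hz n Hn. destruct (Nat.eq_dec n a) as [->|Hna].
  - now rewrite upd_same, !env_same.
  - rewrite upd_other, (env_other a) by auto. apply env_other.
    intros E. apply Hz, in_map_iff. exists n. rewrite in_rem. auto.
Qed.

(** Under the encoding, capture-avoiding substitution is composition of environments: the fresh
    bound names chosen by [subst] disappear. *)
Lemma enc_subst P : forall r s, enc r (subst s P) = enc (fun n => r (s n)) P.
Proof.
  induction P as [l IH|P Q IHP IHQ|a P IHP] using proc_nested_ind; intros r s.
  - rewrite subst_sum. simpl. f_equal. rewrite map_map. apply map_ext_in. intros [p Q] Hin.
    rewrite Forall_forall in IH. specialize (IH _ Hin).
    destruct p as [|a x|a b]; cbn in *; f_equal; auto.
    rewrite IH. apply enc_ext, env_upd_fresh, fresh_not_in.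
  - simpl. now rewrite IHP, IHQ.
  - simpl. f_equal. rewrite IHP. apply enc_ext, env_upd_fresh, fresh_not_in.
Qed.

Lemma up_env x a r : (fun n => up x (env a r n)) = env a (fun k => x (r k)).
Proof. extensionality n. unfold env, upd. now destruct (n =? a). Qed.

Lemma ren_enc P : forall x r, ren x (enc r P) = enc (fun n => x (r n)) P.
Proof.
  induction P as [l IH|P Q IHP IHQ|a P IHP] using proc_nested_ind; intros x r; simpl.
  - f_equal. rewrite map_map. apply map_ext_in. intros [p Q] Hin.
    rewrite Forall_forall in IH. specialize (IH _ Hin).
    destruct p as [|a y|a b]; simpl in *; f_equal; auto.
    rewrite IH. now rewrite up_env.
  - now rewrite IHP, IHQ.
  - now rewrite IHP, up_env.
Qed.

Lemma enc_env_fresh b r P : ~ In b (fn P) -> enc (env b r) P = ren S (enc r P).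
Proof.
  intros H. rewrite ren_enc. apply enc_ext. intros n Hn. apply env_other. congruence.
Qed.

Lemma enc_rename P z x r : ~ In z (rem x (fn P)) -> enc (env z r) (subst1 P z x) = enc (env x r) P.
Proof.
  intros H. unfold subst1. rewrite enc_subst. apply enc_ext, env_upd_fresh.
  now rewrite map_id.
Qed.

Lemma enc_subst1 P b x r : enc r (subst1 P b x) = ren (inst (r b)) (enc (env x r) P).
Proof.
  unfold subst1. rewrite enc_subst, ren_enc. apply enc_ext. intros n _.
  destruct (Nat.eq_dec n x) as [->|Hn].
  - now rewrite upd_same, env_same.
  - now rewrite upd_other, env_other.
Qed.

Lemma env_swap a b r : a <> b -> (fun n => swp (env a (env b r) n)) = env b (env a r).
Proof.
  intros H. extensionality n. unfold env, upd.
  destruct (Nat.eqb_spec n a), (Nat.eqb_spec n b); simpl; congruence.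
Qed.

Lemma swp_enc a b r P : a <> b -> ren swp (enc (env a (env b r)) P) = enc (env b (env a r)) P.
Proof. intros H. rewrite ren_enc. now rewrite env_swap. Qed.

Lemma env_inj a r : inj r -> inj (env a r).
Proof.
  intros H m n E. unfold env, upd in E.
  destruct (Nat.eqb_spec m a), (Nat.eqb_spec n a); try discriminate; try congruence.
  apply H. congruence.
Qed.

Lemma enc_sum_mid r l1 l2 x : enc r (PSum (l1 ++ x :: l2)) =
  DSum (map (fun x => (enc_pre r (fst x), enc (pre_env (fst x) r) (snd x))) l1 ++
        (enc_pre r (fst x), enc (pre_env (fst x) r) (snd x)) ::
        map (fun x => (enc_pre r (fst x), enc (pre_env (fst x) r) (snd x))) l2).
Proof. simpl. now rewrite map_app. Qed.

(** The alpha-conversion rules become equalities of terms; [dcong] is there to absorb the reordering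
    of sums. *)
Lemma aeq_enc P Q : aeq P Q -> forall r, dcong (enc r P) (enc r Q).
Proof.
  induction 1; intros r.
  - apply dcong_refl.
  - apply dcong_sym; auto.
  - eapply dcong_trans; eauto.
  - simpl; auto with dcong.
  - simpl; auto with dcong.
  - simpl; auto with dcong.
  - rewrite !enc_sum_mid. now apply dcong_sum.
  - now apply dcong_perm, Permutation_map.
  - simpl. rewrite enc_rename by assumption. apply dcong_refl.
  - rewrite !enc_sum_mid. simpl. rewrite enc_rename by assumption. apply dcong_refl.
Qed.

Lemma scong_enc P Q : scong P Q -> forall r, dcong (enc r P) (enc r Q).
Proof.
  induction 1; intros r.
  - now apply aeq_enc.
  - apply dcong_refl.
  - apply dcong_sym; auto.
  - eapply dcong_trans; eauto.
  - simpl; auto with dcong.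
  - simpl; auto with dcong.
  - simpl; auto with dcong.
  - rewrite !enc_sum_mid. now apply dcong_sum.
  - apply dcong_comm.
  - apply dcong_assoc.
  - apply dcong_unit.
  - simpl. rewrite (enc_env_fresh a r Q) by assumption. apply dcong_nu_par.
  - apply dcong_nu_nil.
  (* For equal binders both sides are the same term; otherwise exchanging them is [swp]. *)
  - simpl. destruct (Nat.eq_dec a b) as [->|Hab]; [apply dcong_refl|].
    rewrite <- (swp_enc b a) by auto. apply dcong_nu_nu.
Qed.

(** * From early to late transitions *)

Lemma tr_enc_sum r l p P : In (p, P) l ->
  tr (enc r (PSum l)) (Act (enc_pre r p)) (enc (pre_env p r) P).
Proof. intros H. apply tr_act, in_map_iff. exists (p, P). auto. Qed.

(** An early input of [b] is a late input instantiated at [b], and an extruded [b] becomes index 0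
    through [env b r]. All environments are covered at once, since restrictions and closes change
    the environment within the induction. *)
Lemma lts_tr P l P' : lts P l P' -> forall r,
  match l with
  | LTau => exists t, tr (enc r P) (Act DTau) t /\ dcong t (enc r P')
  | LOut a b => exists t, tr (enc r P) (Act (DOut (r a) (r b))) t /\ dcong t (enc r P')
  | LIn a b => exists t, tr (enc r P) (Act (DIn (r a))) t /\ dcong (ren (inst (r b)) t) (enc r P')
  | LBOut a b => exists t, tr (enc r P) (Bout (r a)) t /\ dcong t (enc (env b r) P')
  end.
Proof.
  (* A close receives a name fresh for the receiver, whereas the late rule leaves the input
     uninstantiated. The induction hypothesis at [env b r], where [b] is index 0 and [Q] is
     weakened, recovers that residual. *)
  assert (Hclose : forall r Q Q' a b, ~ In b (fn Q) ->
    (forall r, exists t, tr (enc r Q) (Act (DIn (r a))) t /\ dcong (ren (inst (r b)) t) (enc r Q')) ->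
    exists t, tr (enc r Q) (Act (DIn (r a))) t /\ dcong t (enc (env b r) Q')).
  { intros r Q Q' a b Hb IH. destruct (IH (env b r)) as (t&Ht&Hd).
    rewrite enc_env_fresh in Ht by assumption.
    apply tr_shift_inv in Ht as ([[]|]&t0&Ht&E&->); try discriminate.
    injection E as E. destruct (Nat.eq_dec a b) as [->|Hab].
    { now rewrite env_same in E. }
    rewrite env_other in E by auto. injection E as <-.
    exists t0. split; [assumption|]. rewrite env_same in Hd.
    simpl in Hd. rewrite ren_ren in Hd. rewrite ren_pointwise_id in Hd; [assumption|cases_nat]. }
  induction 1; intros r.
  - eexists; split; [exact (tr_enc_sum r _ _ _ H)|apply dcong_refl].
  - eexists; split; [exact (tr_enc_sum r _ _ _ H)|apply dcong_refl].
  - eexists; split; [exact (tr_enc_sum r _ _ _ H)|]. rewrite enc_subst1. apply dcong_refl.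
  - specialize (IHlts r). destruct l; simpl in H0; destruct IHlts as (t&Ht&Hd);
      (eexists; split; [apply tr_par_l; eassumption|]); simpl.
    + auto with dcong.
    + rewrite inst_shift. auto with dcong.
    + auto with dcong.
    + rewrite (enc_env_fresh n0 r Q) by auto. auto with dcong.
  - specialize (IHlts r). destruct l; simpl in H0; destruct IHlts as (t&Ht&Hd);
      (eexists; split; [apply tr_par_r; eassumption|]); simpl.
    + auto with dcong.
    + rewrite inst_shift. auto with dcong.
    + auto with dcong.
    + rewrite (enc_env_fresh n0 r P) by auto. auto with dcong.
  - destruct (IHlts1 r) as (t&Ht&Hd), (IHlts2 r) as (u&Hu&He).
    eexists; split; [eapply tr_com_l; eassumption|]. simpl. auto with dcong.
  - destruct (IHlts1 r) as (t&Ht&Hd), (IHlts2 r) as (u&Hu&He).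
    eexists; split; [eapply tr_com_r; eassumption|]. simpl. auto with dcong.
  - destruct (IHlts1 r) as (t&Ht&Hd), (Hclose r _ _ _ _ H1 IHlts2) as (u&Hu&He).
    eexists; split; [eapply tr_close_l; eassumption|]. simpl. auto with dcong.
  - destruct (Hclose r _ _ _ _ H1 IHlts1) as (t&Ht&Hd), (IHlts2 r) as (u&Hu&He).
    eexists; split; [eapply tr_close_r; eassumption|]. simpl. auto with dcong.
  - specialize (IHlts (env a r)). destruct l; simpl in H0; destruct IHlts as (t&Ht&Hd);
      rewrite ?env_other in * by firstorder congruence.
    + eexists; split; [apply (tr_res _ (Act DTau)); eassumption|]. simpl. auto with dcong.
    + eexists; split; [apply (tr_res _ (Act (DIn _))); eassumption|]. simpl.
      apply dcong_nu. eapply dcong_trans; [|exact Hd]. apply dcong_of_eq. solve_ren.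
    + eexists; split; [apply (tr_res _ (Act (DOut _ _))); eassumption|]. simpl. auto with dcong.
    + eexists; split; [apply (tr_res _ (Bout _)); eassumption|]. simpl.
      rewrite <- (swp_enc n0 a) by firstorder congruence. auto with dcong.
  - specialize (IHlts (env b r)). destruct IHlts as (t&Ht&Hd).
    rewrite env_same, env_other in Ht by auto.
    eexists; split; [apply tr_open; eassumption|assumption].
  - specialize (IHlts r). apply aeq_enc with (r := r), dcong_sym in H.
    destruct l; destruct IHlts as (t&Ht&Hd); destruct (dcong_tr _ _ _ _ H Ht) as (t'&Ht'&Hd');
      exists t'; (split; [assumption|]);
      (eapply dcong_trans; [|exact Hd]); auto using dcong_ren, dcong_sym.
Qed.

(** * Transitions and reductions of processes through the translation *)

(** Up to alpha-conversion the bound name can be chosen as any [z] not free in [P]. *)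
Lemma enc_nu_inv r P t z : enc r P = DNu t -> ~ In z (fn P) ->
  exists P0, enc (env z r) P0 = t /\ aeq P (PNu z P0) /\
    forall n, n <> z -> In n (fn P0) -> In n (fn P).
Proof.
  destruct P as [l|P Q|x P]; try discriminate. simpl. intros E Hz. injection E as <-.
  exists (subst1 P z x). split; [now apply enc_rename|]. split; [now apply aeq_alpha_nu|].
  intros n Hn H. apply in_fn_subst in H as (m&Hm&E). apply in_rem.
  destruct (Nat.eq_dec m x) as [->|Hmx].
  - rewrite upd_same in E. congruence.
  - rewrite upd_other in E by assumption. subst. auto.
Qed.

Lemma enc_par_inv r P t u : enc r P = DPar t u ->
  exists P1 P2, P = PPar P1 P2 /\ enc r P1 = t /\ enc r P2 = u.
Proof. destruct P as [l|P Q|x P]; try discriminate. simpl. intros E. injection E as <- <-. eauto. Qed.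

Lemma enc_sum_inv r P l p t : enc r P = DSum l -> In (p, t) l ->
  exists m q Q, P = PSum m /\ In (q, Q) m /\ p = enc_pre r q /\ t = enc (pre_env q r) Q.
Proof.
  destruct P as [m|P Q|x P]; try discriminate. simpl. intros E. injection E as <-.
  rewrite in_map_iff. intros ([q Q]&E&Hin). injection E as <- <-. eauto 10.
Qed.

Lemma env_S_inv r z a n : S a = env z r n -> n <> z /\ a = r n.
Proof.
  destruct (Nat.eq_dec n z) as [->|H].
  - now rewrite env_same.
  - rewrite env_other by assumption. intros E. split; [assumption|congruence].
Qed.

(** Equality of encodings, rather than [dcong], is attainable because [lt_alpha] adjusts bound names
    beforehand. Injectivity turns equal channel indices into equal names. The second equation for
    inputs gives the residual at a fresh [b], for closing a bound output. *)
Lemma tr_lts t l t' : tr t l t' -> forall r P, inj r -> enc r P = t ->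
  match l with
  | Act DTau => exists P', lts P LTau P' /\ enc r P' = t'
  | Act (DOut x y) => exists a b P', x = r a /\ y = r b /\ lts P (LOut a b) P' /\ enc r P' = t'
  | Act (DIn x) => forall b, exists a P', x = r a /\ lts P (LIn a b) P' /\
      enc r P' = ren (inst (r b)) t' /\ (~ In b (fn P) -> enc (env b r) P' = t')
  | Bout x => forall b, ~ In b (fn P) ->
      exists a P', x = r a /\ lts P (LBOut a b) P' /\ enc (env b r) P' = t'
  end.
Proof.
  assert (Hnobn : forall Q n, In n [] -> ~ In n (fn Q)) by (simpl; tauto).
  assert (Hbn : forall b Q n, ~ In b (fn Q) -> In n [b] -> ~ In n (fn Q)).
  { intros b Q n Hb [<-|[]]. assumption. }
  induction 1; intros r P Hr E.
  - destruct (enc_sum_inv _ _ _ _ _ E H) as (m&q&Q&->&Hin&->&->).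
    destruct q as [|a x|a b]; simpl.
    + exists Q. split; [now apply lt_tau|reflexivity].
    + intros b. exists a, (subst1 Q b x). split; [reflexivity|]. split; [now apply lt_in|].
      split; [apply enc_subst1|]. intros Hb. apply enc_rename.
      intros H'. apply Hb. apply in_fn_sum. exists (PIn a x), Q. simpl. auto.
    + exists a, b, Q. repeat split. now apply lt_out.
  - apply enc_par_inv in E as (P1&P2&->&E1&<-). specialize (IHtr r P1 Hr E1).
    destruct l as [[|x|x y]|x]; simpl.
    + destruct IHtr as (P'&?&<-). eexists; split; [apply lt_par_l; simpl; eauto|reflexivity].
    + intros b. destruct (IHtr b) as (a&P'&->&?&E&Hf).
      exists a, (PPar P' P2). split; [reflexivity|]. split; [apply lt_par_l; simpl; auto|].
      split; simpl; [now rewrite E, inst_shift|].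
      rewrite in_app_iff. intros Hb. rewrite Hf, enc_env_fresh by tauto. reflexivity.
    + destruct IHtr as (a&b&P'&->&->&?&<-).
      exists a, b, (PPar P' P2). repeat split. apply lt_par_l; simpl; auto.
    + intros b Hb. rewrite in_app_iff in Hb. destruct (IHtr b) as (a&P'&->&?&<-); [tauto|].
      exists a, (PPar P' P2). split; [reflexivity|]. split.
      * apply lt_par_l; [assumption|]. intros n. apply Hbn. tauto.
      * simpl. rewrite (enc_env_fresh b r P2) by tauto. reflexivity.
  - apply enc_par_inv in E as (P1&P2&->&<-&E2). specialize (IHtr r P2 Hr E2).
    destruct l as [[|x|x y]|x]; simpl.
    + destruct IHtr as (P'&?&<-). eexists; split; [apply lt_par_r; simpl; eauto|reflexivity].
    + intros b. destruct (IHtr b) as (a&P'&->&?&E&Hf).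
      exists a, (PPar P1 P'). split; [reflexivity|]. split; [apply lt_par_r; simpl; auto|].
      split; simpl; [now rewrite E, inst_shift|].
      rewrite in_app_iff. intros Hb. rewrite Hf, enc_env_fresh by tauto. reflexivity.
    + destruct IHtr as (a&b&P'&->&->&?&<-).
      exists a, b, (PPar P1 P'). repeat split. apply lt_par_r; simpl; auto.
    + intros b Hb. rewrite in_app_iff in Hb. destruct (IHtr b) as (a&P'&->&?&<-); [tauto|].
      exists a, (PPar P1 P'). split; [reflexivity|]. split.
      * apply lt_par_r; [assumption|]. intros n. apply Hbn. tauto.
      * simpl. rewrite (enc_env_fresh b r P1) by tauto. reflexivity.
  - apply enc_par_inv in E as (P1&P2&->&E1&E2).
    destruct (IHtr1 r P1 Hr E1) as (c&d&P'&->&->&?&<-).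
    destruct (IHtr2 r P2 Hr E2 d) as (c'&Q'&Ec&?&E&_). apply Hr in Ec as <-.
    eexists; split; [eapply lt_com_l; eassumption|]. simpl. now rewrite E.
  - apply enc_par_inv in E as (P1&P2&->&E1&E2).
    destruct (IHtr2 r P2 Hr E2) as (c&d&P'&->&->&?&<-).
    destruct (IHtr1 r P1 Hr E1 d) as (c'&Q'&Ec&?&E&_). apply Hr in Ec as <-.
    eexists; split; [eapply lt_com_r; eassumption|]. simpl. now rewrite E.
  - apply enc_par_inv in E as (P1&P2&->&E1&E2).
    (* One name fresh for both components serves as the extruded and as the received name. *)
    pose proof (fresh_not_in (fn P1 ++ fn P2)) as Hb. set (b := fresh _) in Hb.
    rewrite in_app_iff in Hb.
    destruct (IHtr1 r P1 Hr E1 b) as (c&P'&->&?&<-); [tauto|].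
    destruct (IHtr2 r P2 Hr E2 b) as (c'&Q'&Ec&?&_&E). apply Hr in Ec as <-.
    eexists; split; [eapply lt_close_l; eauto|]. simpl. rewrite E by tauto. reflexivity.
  - apply enc_par_inv in E as (P1&P2&->&E1&E2).
    pose proof (fresh_not_in (fn P1 ++ fn P2)) as Hb. set (b := fresh _) in Hb.
    rewrite in_app_iff in Hb.
    destruct (IHtr2 r P2 Hr E2 b) as (c&P'&->&?&<-); [tauto|].
    destruct (IHtr1 r P1 Hr E1 b) as (c'&Q'&Ec&?&_&E). apply Hr in Ec as <-.
    eexists; split; [eapply lt_close_r; eauto|]. simpl. rewrite E by tauto. reflexivity.
  - destruct l as [[|x|x y]|x]; simpl in *.
    + destruct (enc_nu_inv _ _ _ _ E (fresh_not_in _)) as (P0&E0&Ha&Hf).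
      set (z := fresh _) in *.
      destruct (IHtr _ P0 (env_inj z r Hr) E0) as (P'&?&<-).
      exists (PNu z P'). split; [|reflexivity].
      eapply lt_alpha; [eassumption|]. apply lt_res; simpl; auto.
    (* The bound name must also avoid the received [b], which occurs in the label passed through
       [lt_res]. *)
    + intros b. pose proof (fresh_not_in (b :: fn P)) as Hz. set (z := fresh _) in Hz.
      apply not_in_cons in Hz as [Hzb Hz].
      destruct (enc_nu_inv _ _ _ _ E Hz) as (P0&E0&Ha&Hf).
      destruct (IHtr _ P0 (env_inj z r Hr) E0 b) as (a&P'&Ea&?&E1&E2).
      apply env_S_inv in Ea as [Haz ->].
      exists a, (PNu z P'). split; [reflexivity|]. split.
      { eapply lt_alpha; [eassumption|]. apply lt_res; simpl; [assumption|]. intuition congruence. }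
      simpl. rewrite E1, env_other by auto. split; [f_equal; solve_ren|].
      intros Hb. f_equal. rewrite <- E2 by auto. now rewrite swp_enc by auto.
    + destruct (enc_nu_inv _ _ _ _ E (fresh_not_in _)) as (P0&E0&Ha&Hf).
      set (z := fresh _) in *.
      destruct (IHtr _ P0 (env_inj z r Hr) E0) as (a&b&P'&Ea&Eb&?&<-).
      apply env_S_inv in Ea as [Haz ->]. apply env_S_inv in Eb as [Hbz ->].
      exists a, b, (PNu z P'). repeat split.
      eapply lt_alpha; [eassumption|]. apply lt_res; simpl; [assumption|]. intuition congruence.
    + intros b Hb. pose proof (fresh_not_in (b :: fn P)) as Hz. set (z := fresh _) in Hz.
      apply not_in_cons in Hz as [Hzb Hz].
      destruct (enc_nu_inv _ _ _ _ E Hz) as (P0&E0&Ha&Hf).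
      destruct (IHtr _ P0 (env_inj z r Hr) E0 b) as (a&P'&Ea&?&<-); [auto|].
      apply env_S_inv in Ea as [Haz ->].
      exists a, (PNu z P'). split; [reflexivity|]. split.
      { eapply lt_alpha; [eassumption|]. apply lt_res; simpl; [assumption|]. intuition congruence. }
      simpl. f_equal. now rewrite swp_enc by auto.
  - intros b Hb. destruct (enc_nu_inv _ _ _ _ E Hb) as (P0&E0&Ha&Hf).
    destruct (IHtr _ P0 (env_inj b r Hr) E0) as (c&d&P'&Ec&Ed&?&<-).
    apply env_S_inv in Ec as [Hcb ->].
    destruct (Nat.eq_dec d b) as [->|Hd].
    + exists c, P'. repeat split. eapply lt_alpha; [eassumption|]. now apply lt_open.
    + rewrite env_other in Ed by assumption. discriminate.
Qed.

(** * Interactions and the rules of the dialgebra *)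

Lemma com_sym t u v : com t u v -> exists v', com u t v' /\ dcong v v'.
Proof. destruct 1; eexists; split; eauto using com with dcong. Qed.

Lemma com_dc t u v t0 u0 : com t u v -> dcong t t0 -> dcong u u0 -> exists v', com t0 u0 v' /\ dcong v v'.
Proof.
  destruct 1 as [a b t t' u u' Ht Hu|a b t t' u u' Ht Hu|a t t' u u' Ht Hu|a t t' u u' Ht Hu];
    intros Hdt Hdu; destruct (dcong_tr _ _ _ _ Hdt Ht) as (?&?&?), (dcong_tr _ _ _ _ Hdu Hu) as (?&?&?);
    eexists; split; eauto using com with dcong.
Qed.

Lemma com_par t u v s : com t u v -> exists v', com (DPar t s) u v' /\ dcong v' (DPar s v).
Proof.
  assert (H : forall x y z, dcong (DPar (DPar x y) z) (DPar y (DPar x z))).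
  { intros x y z. eapply dcong_trans; [apply dcong_par_l, dcong_comm|apply dcong_assoc]. }
  assert (Hnu : forall x z, dcong (DNu (DPar (DPar x (ren S s)) z)) (DPar s (DNu (DPar x z)))).
  { intros x z. eapply dcong_trans; [apply dcong_nu, H|apply dcong_nu_par_r]. }
  destruct 1; (eexists; split;
    [econstructor; [eapply tr_par_l; eassumption|eassumption]|simpl; rewrite ?inst_shift; auto]).
Qed.

Scheme step1_mut := Minimality for step1 Sort Prop
  with step2_mut := Minimality for step2 Sort Prop.
Combined Scheme step_ind from step1_mut, step2_mut.

(** By mutual induction: [com_nu], [com_par], [com_sym] and the bisimulation property of [dcong]
    account for hiding, parallel composition, symmetry and structural congruence. *)
Lemma step_tr :
  (forall P P', step1 P P' -> forall r, exists t, tr (enc r P) (Act DTau) t /\ dcong t (enc r P')) /\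
  (forall P Q R, step2 P Q R -> forall r, exists t, com (enc r P) (enc r Q) t /\ dcong t (enc r R)).
Proof.
  apply step_ind.
  - intros l P H r. eexists; split; [exact (tr_enc_sum r _ _ _ H)|apply dcong_refl].
  - intros a P P' _ IH r. destruct (IH (env a r)) as (t&Ht&Hd).
    eexists; split; [apply (tr_res _ (Act DTau)); eassumption|]. simpl; auto with dcong.
  - intros P P' Q _ IH r. destruct (IH r) as (t&Ht&Hd).
    eexists; split; [apply tr_par_l; eassumption|]. simpl; auto with dcong.
  - intros P Q R _ IH r. destruct (IH r) as (t&Ht&Hd). eauto using com_tr.
  - intros P Q R U _ IH HPQ HRU r. destruct (IH r) as (t&Ht&Hd).
    destruct (dcong_tr _ _ _ _ (scong_enc _ _ HPQ r) Ht) as (t'&Ht'&Hd').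
    exists t'. split; [assumption|].
    eapply dcong_trans; [apply dcong_sym, Hd'|]. eapply dcong_trans; [exact Hd|]. now apply scong_enc.
  - intros a P Q R _ IH Ha r. destruct (IH (env a r)) as (t&Ht&Hd).
    rewrite (enc_env_fresh a r Q Ha) in Ht. apply com_nu in Ht as (v&Hv&Hdv).
    exists v. split; [assumption|]. eapply dcong_trans; [exact Hdv|]. simpl; auto with dcong.
  - intros P Q R U _ IH r. destruct (IH r) as (t&Ht&Hd).
    destruct (com_par _ _ _ (enc r U) Ht) as (v&Hv&Hdv).
    exists v. split; [assumption|]. eapply dcong_trans; [exact Hdv|]. simpl; auto with dcong.
  - intros a b y P Q l1 l2 H1 H2 r. eexists; split.
    + eapply com_com_l; [exact (tr_enc_sum r _ _ _ H1)|exact (tr_enc_sum r _ _ _ H2)].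
    + simpl. rewrite enc_subst1. apply dcong_refl.
  - intros P Q R _ IH r. destruct (IH r) as (t&Ht&Hd).
    destruct (com_sym _ _ _ Ht) as (v&Hv&Hdv). exists v. split; [assumption|].
    eapply dcong_trans; [apply dcong_sym, Hdv|assumption].
  - intros P Q R U T V _ IH HP HQ HR r. destruct (IH r) as (t&Ht&Hd).
    destruct (com_dc _ _ _ _ _ Ht (scong_enc _ _ HP r) (scong_enc _ _ HQ r)) as (v&Hv&Hdv).
    exists v. split; [assumption|].
    eapply dcong_trans; [apply dcong_sym, Hdv|]. eapply dcong_trans; [exact Hd|]. now apply scong_enc.
Qed.

Lemma step2_par_r P Q R U : step2 P Q R -> step2 (PPar U P) Q (PPar U R).
Proof.
  intros H. eapply st_str2; [apply st_par2, H|apply sc_par_comm|apply sc_refl|apply sc_refl].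
Qed.

Lemma step2_alpha P Q R z P0 : aeq P (PNu z P0) -> ~ In z (fn Q) -> step2 P0 Q R -> step2 P Q (PNu z R).
Proof.
  intros Ha Hz H. eapply st_str2; [apply st_hid; eassumption|..]; [|apply sc_refl..].
  now apply sc_sym, sc_alpha.
Qed.

Lemma step2_of_input u l u' : tr u l u' -> forall r Q a, inj r -> enc r Q = u -> l = Act (DIn (r a)) ->
  forall m b P, In (POut a b, P) m ->
  exists R, step2 (PSum m) Q R /\ dcong (enc r R) (DPar (enc r P) (ren (inst (r b)) u')).
Proof.
  induction 1; intros r Q c Hr E El m d P Hin; try discriminate.
  - injection El as ->. destruct (enc_sum_inv _ _ _ _ _ E H) as (k&q&Q0&->&Hin'&Eq&->).
    destruct q as [|e x|e x]; try discriminate. injection Eq as Ee. apply Hr in Ee as <-.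
    eexists; split; [eapply st_com; eassumption|]. simpl. rewrite enc_subst1. apply dcong_refl.
  - subst l. apply enc_par_inv in E as (Q1&Q2&->&E1&<-).
    destruct (IHtr r Q1 c Hr E1 eq_refl m d P Hin) as (R&HR&Hd).
    exists (PPar Q2 R). split; [apply st_sym, st_par2, st_sym, HR|]. simpl. rewrite inst_shift.
    eapply dcong_trans; [apply dcong_par_r, Hd|]. eapply dcong_trans; [apply dcong_comm|]. apply dcong_assoc.
  - subst l. apply enc_par_inv in E as (Q1&Q2&->&<-&E2).
    destruct (IHtr r Q2 c Hr E2 eq_refl m d P Hin) as (R&HR&Hd).
    exists (PPar Q1 R). split; [apply st_sym, step2_par_r, st_sym, HR|]. simpl. rewrite inst_shift.
    eapply dcong_trans; [apply dcong_par_r, Hd|].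
    eapply dcong_trans; [apply dcong_sym, dcong_assoc|].
    eapply dcong_trans; [apply dcong_par_l, dcong_comm|]. apply dcong_assoc.
  (* The receiver's restriction is renamed apart from the sender, so that [st_hid], conjugated by
     [st_sym], moves it outwards. *)
  - subst l. pose proof (fresh_not_in (fn (PSum m) ++ fn Q)) as Hz. set (z := fresh _) in Hz.
    rewrite in_app_iff in Hz.
    destruct (enc_nu_inv _ _ _ z E) as (Q0&E0&Ha&_); [tauto|].
    assert (Hm : forall n, In n (c :: d :: fn P) -> n <> z).
    { intros n Hn ->. apply Hz. left. apply in_fn_sum. eauto. }
    destruct (IHtr _ Q0 c (env_inj z r Hr) E0) with (m := m) (b := d) (P := P) as (R&HR&Hd).
    { simpl. rewrite env_other; [reflexivity|]. apply Hm. simpl; auto. }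
    { assumption. }
    exists (PNu z R). split.
    + apply st_sym. eapply step2_alpha; [eassumption|tauto|]. now apply st_sym.
    + simpl. rewrite (enc_env_fresh z r P), env_other in Hd.
      * eapply dcong_trans; [apply dcong_nu, Hd|]. eapply dcong_trans; [apply dcong_nu_par_r|].
        apply dcong_par_r, dcong_nu, dcong_of_eq. solve_ren.
      * apply Hm. simpl; auto.
      * intros Hn. apply (Hm z); simpl; auto.
Qed.

(** Free and bound outputs are treated in one induction, since opening a restriction turns the
    former into the latter. *)
Lemma step2_of_output t l t' : tr t l t' -> forall r P Q u', inj r -> enc r P = t ->
  match l with
  | Act (DOut a b) => tr (enc r Q) (Act (DIn a)) u' ->
      exists R, step2 P Q R /\ dcong (enc r R) (DPar t' (ren (inst b) u'))
  | Bout a => tr (enc r Q) (Act (DIn a)) u' ->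
      exists R, step2 P Q R /\ dcong (enc r R) (DNu (DPar t' u'))
  | _ => True
  end.
Proof.
  assert (Hnu : forall x y z, dcong (DPar z (DNu (DPar x y))) (DNu (DPar (DPar x (ren S z)) y))).
  { intros x y z. eapply dcong_trans; [apply dcong_sym, dcong_nu_par_r|]. apply dcong_nu.
    eapply dcong_trans; [apply dcong_sym, dcong_assoc|]. auto with dcong. }
  assert (Hpar : forall x y z, dcong (DPar z (DPar x y)) (DPar (DPar x z) y)).
  { intros x y z. eapply dcong_trans; [apply dcong_sym, dcong_assoc|]. auto with dcong. }
  induction 1; intros r P Q w Hr E; try exact I.
  - destruct (enc_sum_inv _ _ _ _ _ E H) as (m&q&P0&->&Hin&->&->).
    destruct q as [|a x|a b]; try exact I. simpl. intros Hw.
    eapply step2_of_input; eauto.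
  - apply enc_par_inv in E as (P1&P2&->&E1&<-). specialize (IHtr r P1 Q w Hr E1).
    destruct l as [[|x|x y]|x]; try exact I; intros Hw; destruct (IHtr Hw) as (R&HR&Hd);
      exists (PPar P2 R); (split; [now apply st_par2|]);
      (eapply dcong_trans; [apply dcong_par_r, Hd|]); auto.
  - apply enc_par_inv in E as (P1&P2&->&<-&E2). specialize (IHtr r P2 Q w Hr E2).
    destruct l as [[|x|x y]|x]; try exact I; intros Hw; destruct (IHtr Hw) as (R&HR&Hd);
      exists (PPar P1 R); (split; [now apply step2_par_r|]);
      (eapply dcong_trans; [apply dcong_par_r, Hd|]).
    + apply dcong_sym, dcong_assoc.
    + eapply dcong_trans; [apply Hnu|]. simpl. auto with dcong.
  - pose proof (fresh_not_in (fn P ++ fn Q)) as Hz. set (z := fresh _) in Hz.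
    rewrite in_app_iff in Hz.
    destruct (enc_nu_inv _ _ _ z E) as (P0&E0&Ha&_); [tauto|].
    specialize (IHtr _ P0 Q (ren (up S) w) (env_inj z r Hr) E0).
    rewrite enc_env_fresh in IHtr by tauto.
    destruct l as [[|x|x y]|x]; try exact I; intros Hw; simpl in IHtr;
      apply (tr_ren _ _ _) with (r := S) in Hw; destruct (IHtr Hw) as (R&HR&Hd);
      exists (PNu z R); (split; [eapply step2_alpha; [eassumption|tauto|assumption]|]);
      (eapply dcong_trans; [apply dcong_nu, Hd|]); simpl.
    + replace (ren (inst (S y)) (ren (up S) w)) with (ren S (ren (inst y) w)) by solve_ren.
      apply dcong_nu_par.
    + eapply dcong_trans; [apply dcong_nu_nu|]. eapply dcong_trans; [|apply dcong_nu, dcong_nu_par].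
      apply dcong_of_eq. simpl. do 3 f_equal. solve_ren.
  (* Opening: beneath the restriction the output is a free one of index 0, and [st_hid] then
     restricts the result just as a close does. *)
  - pose proof (fresh_not_in (fn P ++ fn Q)) as Hz. set (z := fresh _) in Hz.
    rewrite in_app_iff in Hz. intros Hw.
    destruct (enc_nu_inv _ _ _ z E) as (P0&E0&Ha&_); [tauto|].
    specialize (IHtr _ P0 Q (ren (up S) w) (env_inj z r Hr) E0).
    rewrite enc_env_fresh in IHtr by tauto.
    apply (tr_ren _ _ _) with (r := S) in Hw. destruct (IHtr Hw) as (R&HR&Hd).
    exists (PNu z R). split; [eapply step2_alpha; [eassumption|tauto|assumption]|].
    simpl. eapply dcong_trans; [apply dcong_nu, Hd|]. apply dcong_of_eq. do 2 f_equal. solve_ren.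
Qed.

Lemma com_step r P Q v : inj r -> com (enc r P) (enc r Q) v ->
  exists R, step2 P Q R /\ dcong (enc r R) v.
Proof.
  intros Hr H. inv H.
  - exact (step2_of_output _ _ _ H0 r P Q u' Hr eq_refl H1).
  - destruct (step2_of_output _ _ _ H1 r Q P t' Hr eq_refl H0) as (R&HR&Hd).
    exists R. split; [now apply st_sym|]. eapply dcong_trans; [exact Hd|]. apply dcong_comm.
  - exact (step2_of_output _ _ _ H0 r P Q u' Hr eq_refl H1).
  - destruct (step2_of_output _ _ _ H1 r Q P t' Hr eq_refl H0) as (R&HR&Hd).
    exists R. split; [now apply st_sym|]. eapply dcong_trans; [exact Hd|]. auto with dcong.
Qed.

Lemma tr_step t l t' : tr t l t' -> forall r P, inj r -> enc r P = t -> l = Act DTau ->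
  exists P', step1 P P' /\ dcong (enc r P') t'.
Proof.
  induction 1; intros r P Hr E El; try discriminate; subst;
    try (apply enc_par_inv in E as (P1&P2&->&<-&<-));
    (* This settles the four interaction cases; a silent prefix, a move of one component and a
       restriction remain. *)
    try (edestruct (com_step r P1 P2) as (R&HR&Hd);
         [assumption|econstructor; eassumption|exists R; split; [now apply st_int|exact Hd]]).
  - injection El as ->. destruct (enc_sum_inv _ _ _ _ _ E H) as (m&q&Q&->&Hin&Eq&->).
    destruct q; try discriminate. exists Q. split; [now apply st_tau|apply dcong_refl].
  - destruct (IHtr r P1 Hr eq_refl eq_refl) as (P'&HP&Hd).
    exists (PPar P' P2). split; [now apply st_par1|]. simpl. auto with dcong.
  - destruct (IHtr r P2 Hr eq_refl eq_refl) as (P'&HP&Hd).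
    exists (PPar P1 P'). split; [|simpl; auto with dcong].
    eapply st_str1; [apply st_par1, HP|apply sc_par_comm|apply sc_par_comm].
  - destruct (enc_nu_inv _ _ _ _ E (fresh_not_in _)) as (P0&E0&Ha&Hf).
    set (z := fresh _) in *.
    destruct (IHtr _ P0 (env_inj z r Hr) E0 eq_refl) as (P'&HP&Hd).
    exists (PNu z P'). split; [|simpl; auto with dcong].
    eapply st_str1; [apply st_res, HP| |apply sc_refl]. now apply sc_sym, sc_alpha.
Qed.

Notation ident := (fun n : nat => n).

Lemma inj_ident : inj ident.
Proof. easy. Qed.

(** Prepares a body for a binder: index 0 must become the bound name, so names are shifted down by
    one and the old [0] is sent to [x], which lies above all free names. *)
Lemma enc_rebind P : exists x Q, enc (env x ident) Q = enc ident P.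
Proof.
  pose (x := fresh (fn P)).
  exists x, (subst (fun n => match n with 0 => x | S m => m end) P).
  rewrite enc_subst. apply enc_ext. intros [|n] Hn.
  - apply env_same.
  - apply env_other. apply in_lt_fresh in Hn. subst x. lia.
Qed.

(** Lets the testers of barbed equivalence range over de Bruijn terms. *)
Lemma enc_surj t : exists P, enc ident P = t.
Proof.
  induction t as [l IH|t u (P&<-) (Q&<-)|t (P&<-)] using db_nested_ind.
  - cut (exists m, map (fun x => (enc_pre ident (fst x), enc (pre_env (fst x) ident) (snd x))) m = l).
    { intros (m&<-). now exists (PSum m). }
    induction IH as [|[p t] l (P&E) _ (m&<-)]; [now exists []|]. simpl in E. subst t.
    destruct p as [|a|a b].
    + now exists ((PTau, P) :: m).
    + destruct (enc_rebind P) as (x&Q&E). exists ((PIn a x, Q) :: m). simpl. now rewrite E.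
    + now exists ((POut a b, P) :: m).
  - now exists (PPar P Q).
  - destruct (enc_rebind P) as (x&Q&E). exists (PNu x Q). simpl. now rewrite E.
Qed.

(** * Barbed equivalence *)

Definition has_in (t : db) (a : nat) : Prop := exists t', tr t (Act (DIn a)) t'.
Definition has_out (t : db) (a : nat) : Prop :=
  (exists b t', tr t (Act (DOut a b)) t') \/ (exists t', tr t (Bout a) t').

Definition db_bisimulation (R : db -> db -> Prop) : Prop :=
  forall t u, R t u ->
    R u t /\
    (forall a, has_in t a -> has_in u a) /\
    (forall a, has_out t a -> has_out u a) /\
    (forall t', tr t (Act DTau) t' -> exists u', tr u (Act DTau) u' /\ R t' u').

Definition db_bisim (t u : db) : Prop := exists R, db_bisimulation R /\ R t u.
Definition db_equiv (t u : db) : Prop := forall s, db_bisim (DPar t s) (DPar u s).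

Lemma db_bisim_bisimulation : db_bisimulation db_bisim.
Proof.
  intros t u (R&HR&Htu). destruct (HR _ _ Htu) as (H1&H2&H3&H4).
  split; [exists R; auto|]. split; [assumption|]. split; [assumption|].
  intros t' Ht. destruct (H4 _ Ht) as (u'&?&?). exists u'. split; [assumption|]. exists R; auto.
Qed.

Lemma db_bisim_sym t u : db_bisim t u -> db_bisim u t.
Proof. intros H. apply (db_bisim_bisimulation _ _ H). Qed.

Lemma db_bisim_in t u a : db_bisim t u -> has_in t a -> has_in u a.
Proof. intros H. apply (db_bisim_bisimulation _ _ H). Qed.

Lemma db_bisim_tau t u t' : db_bisim t u -> tr t (Act DTau) t' -> exists u', tr u (Act DTau) u' /\ db_bisim t' u'.
Proof. intros H. apply (db_bisim_bisimulation _ _ H). Qed.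

Lemma dcong_in t u a : dcong t u -> has_in t a -> has_in u a.
Proof. intros H (t'&Ht). destruct (dcong_tr _ _ _ _ H Ht) as (u'&?&_). now exists u'. Qed.

Lemma dcong_out t u a : dcong t u -> has_out t a -> has_out u a.
Proof.
  intros H [(b&t'&Ht)|(t'&Ht)]; destruct (dcong_tr _ _ _ _ H Ht) as (u'&?&_); [left|right]; eauto.
Qed.

Lemma db_bisim_dc t u : dcong t u -> db_bisim t u.
Proof.
  intros H. exists dcong. split; [|assumption]. clear. intros t u H.
  split; [now apply dcong_sym|]. split; [intros a; now apply dcong_in|]. split; [intros a; now apply dcong_out|].
  intros t' Ht. exact (dcong_tr _ _ _ _ H Ht).
Qed.

Lemma db_bisim_trans t u v : db_bisim t u -> db_bisim u v -> db_bisim t v.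
Proof.
  intros H1 H2. exists (fun t v => exists u, db_bisim t u /\ db_bisim u v). split; [|eauto]. clear.
  intros t v (u&H1&H2).
  destruct (db_bisim_bisimulation _ _ H1) as (S1&I1&O1&T1), (db_bisim_bisimulation _ _ H2) as (S2&I2&O2&T2).
  split; [eauto|]. split; [auto|]. split; [auto|].
  intros t' Ht. destruct (T1 _ Ht) as (u'&Hu&?), (T2 _ Hu) as (v'&?&?). eauto.
Qed.

Lemma db_equiv_sym t u : db_equiv t u -> db_equiv u t.
Proof. intros H s. apply db_bisim_sym, H. Qed.

Lemma db_equiv_trans t u v : db_equiv t u -> db_equiv u v -> db_equiv t v.
Proof. intros H1 H2 s. eapply db_bisim_trans; eauto. Qed.

Lemma db_equiv_dc t u : dcong t u -> db_equiv t u.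
Proof. intros H s. apply db_bisim_dc. auto with dcong. Qed.

Lemma db_equiv_par_l t u s : db_equiv t u -> db_equiv (DPar t s) (DPar u s).
Proof.
  intros H x. eapply db_bisim_trans; [apply db_bisim_dc, dcong_assoc|].
  eapply db_bisim_trans; [apply H|]. apply db_bisim_dc, dcong_sym, dcong_assoc.
Qed.

Lemma db_equiv_db_bisim t u : db_equiv t u -> db_bisim t u.
Proof.
  intros H. eapply db_bisim_trans; [apply db_bisim_dc, dcong_sym, dcong_unit|].
  eapply db_bisim_trans; [apply H|]. apply db_bisim_dc, dcong_unit.
Qed.

Lemma enc_tau P t : tr (enc ident P) (Act DTau) t -> exists P', lts P LTau P' /\ enc ident P' = t.
Proof. intros H. exact (tr_lts _ _ _ H ident P inj_ident eq_refl). Qed.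

Lemma enc_in P a : barb_in P a <-> has_in (enc ident P) a.
Proof.
  split.
  - intros (b&P'&H). destruct (lts_tr _ _ _ H ident) as (t&Ht&_). now exists t.
  - intros (t&Ht). destruct (tr_lts _ _ _ Ht ident P inj_ident eq_refl 0) as (c&P'&->&H&_).
    now exists 0, P'.
Qed.

Lemma enc_out P a : barb_out P a <-> has_out (enc ident P) a.
Proof.
  split.
  - intros (b&P'&[H|H]); destruct (lts_tr _ _ _ H ident) as (t&Ht&_); [left|right]; eauto.
  - intros [(b&t&Ht)|(t&Ht)].
    + destruct (tr_lts _ _ _ Ht ident P inj_ident eq_refl) as (c&d&P'&->&->&H&_).
      exists d, P'; auto.
    + destruct (tr_lts _ _ _ Ht ident P inj_ident eq_refl _ (fresh_not_in _)) as (c&P'&->&H&_).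
      eexists _, P'; eauto.
Qed.

Lemma barbed_bisim_enc P Q : barbed_bisim P Q <-> db_bisim (enc ident P) (enc ident Q).
Proof.
  split.
  - intros (R&HR&HPQ).
    (* Closed under [dcong] because early transitions carry over to the encoding only up to
       [dcong]. *)
    exists (fun t u => exists P Q, R P Q /\ dcong t (enc ident P) /\ dcong u (enc ident Q)).
    split; [|eauto using dcong_refl]. clear P Q HPQ. intros t u (P&Q&HPQ&Ht&Hu).
    destruct (HR _ _ HPQ) as (S1&I1&O1&T1). split; [eauto|]. split; [|split].
    + intros a H. eapply dcong_in; [apply dcong_sym, Hu|]. apply enc_in, I1, enc_in.
      eapply dcong_in; eassumption.
    + intros a H. eapply dcong_out; [apply dcong_sym, Hu|]. apply enc_out, O1, enc_out.
      eapply dcong_out; eassumption.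
    + intros t' H. destruct (dcong_tr _ _ _ _ Ht H) as (t1&H1&Hd).
      apply enc_tau in H1 as (P'&HP&<-). destruct (T1 _ HP) as (Q'&HQ&HR').
      destruct (lts_tr _ _ _ HQ ident) as (u1&Hu1&Hd1).
      destruct (dcong_tr _ _ _ _ (dcong_sym _ _ Hu) Hu1) as (u'&Hu'&Hd').
      exists u'. split; [assumption|]. exists P', Q'. eauto using dcong_trans, dcong_sym.
  - intros HPQ. exists (fun P Q => db_bisim (enc ident P) (enc ident Q)). split; [|assumption].
    clear. intros P Q HPQ. destruct (db_bisim_bisimulation _ _ HPQ) as (S1&I1&O1&T1).
    split; [assumption|]. split; [|split].
    + intros a. rewrite !enc_in. auto.
    + intros a. rewrite !enc_out. auto.
    + intros P' HP. destruct (lts_tr _ _ _ HP ident) as (t&Ht&Hd).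
      destruct (T1 _ Ht) as (u&Hu&Hbb). apply enc_tau in Hu as (Q'&HQ&<-).
      exists Q'. split; [assumption|]. eapply db_bisim_trans; [apply db_bisim_dc, dcong_sym, Hd|assumption].
Qed.

Lemma barbed_equiv_enc P Q : barbed_equiv P Q <-> db_equiv (enc ident P) (enc ident Q).
Proof.
  split.
  - intros H s. destruct (enc_surj s) as (R&<-). exact (proj1 (barbed_bisim_enc _ _) (H R)).
  - intros H R. apply barbed_bisim_enc. apply H.
Qed.

(** * Fresh names, guards and testers *)

Definition skip (w n : nat) : nat := if n <? w then n else S n.
(* Freshness as membership in the range of a renaming that omits [w], so that the inversion lemma for
   injective renamings [tr_ren_inv] yields its preservation along transitions. *)
Definition free_of (w : nat) (t : db) : Prop := exists u, t = ren (skip w) u.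

Lemma skip_neq w n : skip w n <> w.
Proof. unfold skip. destruct (Nat.ltb_spec n w); lia. Qed.

Lemma skip_inj w : inj (skip w).
Proof. intros m n. unfold skip. destruct (Nat.ltb_spec m w), (Nat.ltb_spec n w); lia. Qed.

Lemma free_of_enc w P : ~ In w (fn P) -> free_of w (enc ident P).
Proof.
  (* The environment is the inverse of [skip w] on the names other than [w]. *)
  intros H. exists (enc (fun n => if n <? w then n else pred n) P).
  rewrite ren_enc. apply enc_ext. intros n Hn. unfold skip.
  assert (n <> w) by congruence.
  destruct (Nat.ltb_spec n w) as [Hlt|Hge]; [now apply Nat.ltb_lt in Hlt as ->|].
  destruct (Nat.ltb_spec (pred n) w); lia.
Qed.

(** All large names are fresh, so that two distinct fresh barbs can be had at once. *)
Lemma free_of_all L : exists n, forall w, n <= w -> Forall (free_of w) L.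
Proof.
  induction L as [|t L (n&Hn)]; [exists 0; auto|].
  destruct (enc_surj t) as (P&<-). exists (n + fresh (fn P)). intros w Hw.
  constructor; [|apply Hn; lia]. apply free_of_enc. intros H. apply in_lt_fresh in H. lia.
Qed.

Lemma free_of_par w t u : free_of w t -> free_of w u -> free_of w (DPar t u).
Proof. intros (t0&->) (u0&->). now exists (DPar t0 u0). Qed.

Lemma free_of_tau w t t' : free_of w t -> tr t (Act DTau) t' -> free_of w t'.
Proof.
  intros (u&->) H. destruct (tr_ren_inv _ _ _ H _ _ (skip_inj w) eq_refl) as ([[]|]&u'&_&E&->);
    try discriminate. now exists u'.
Qed.

Lemma free_of_in w t : free_of w t -> ~ has_in t w.
Proof.
  intros (u&->) (t'&H). destruct (tr_ren_inv _ _ _ H _ _ (skip_inj w) eq_refl) as ([[]|]&u'&_&E&_);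
    try discriminate. injection E as E. now apply (skip_neq w n).
Qed.

Lemma free_of_out w t : free_of w t -> ~ has_out t w.
Proof.
  intros (u&->) [(b&t'&H)|(t'&H)];
  destruct (tr_ren_inv _ _ _ H _ _ (skip_inj w) eq_refl) as ([[]|]&u'&_&E&_);
    try discriminate; injection E; intros; now apply (skip_neq w n).
Qed.

Lemma has_in_par t u a : has_in (DPar t u) a -> has_in t a \/ has_in u a.
Proof. intros (v&H). inv H; [left|right]; eexists; eassumption. Qed.

Lemma has_in_par_r t u a : has_in u a -> has_in (DPar t u) a.
Proof. intros (v&H). eexists. apply tr_par_r. eassumption. Qed.

(** The process [w(y).0 + tau.s], whose barb [w] signals that [s] has not been released yet. *)
Definition guard (w : nat) (s : db) : db := DSum [(DIn w, DNil); (DTau, s)].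

Lemma guard_in w s : has_in (guard w s) w.
Proof. exists DNil. apply tr_act. simpl. auto. Qed.

Lemma guard_tau w s : tr (guard w s) (Act DTau) s.
Proof. apply tr_act. simpl. auto. Qed.

Lemma guard_tr w s l v : tr (guard w s) l v -> l = Act (DIn w) \/ l = Act DTau /\ v = s.
Proof.
  intros H. apply tr_sum_inv in H as (p&->&[E|[E|[]]]); injection E as <- <-; auto.
Qed.

Lemma com_guard w t s v : free_of w t -> ~ com t (guard w s) v.
Proof.
  intros Hf H. inv H;
    match goal with H : tr (guard _ _) _ _ |- _ =>
      apply guard_tr in H as [E|[E _]]; try discriminate E; injection E as ->
    end; eapply free_of_out; eauto; [left|right]; eauto.
Qed.

Lemma par_guard_tau w t s v : free_of w t -> tr (DPar t (guard w s)) (Act DTau) v ->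
  (exists t', tr t (Act DTau) t' /\ v = DPar t' (guard w s)) \/ v = DPar t s.
Proof.
  intros Hf H. apply tr_par_tau in H as [H|[(u'&H&->)|H]].
  - auto.
  - apply guard_tr in H as [E|[_ ->]]; [discriminate|auto].
  - destruct (com_guard _ _ _ _ Hf H).
Qed.

(* A match of [guard w s -> s] must drop the barb [w], so it is the same step. *)
Lemma guard_release w t u s : free_of w t -> free_of w u -> free_of w s ->
  db_bisim (DPar t (guard w s)) (DPar u (guard w s)) -> db_bisim (DPar t s) (DPar u s).
Proof.
  intros Ht Hu Hs H. destruct (db_bisim_tau _ _ _ H (tr_par_r _ _ _ _ (guard_tau w s))) as (v&Hv&Hb).
  apply par_guard_tau in Hv as [(u'&_&->)| ->]; [|assumption|assumption].
  destruct (free_of_in w (DPar t s)); [now apply free_of_par|].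
  eapply db_bisim_in; [apply db_bisim_sym, Hb|]. apply has_in_par_r, guard_in.
Qed.

(** Selecting the branch [guard w s] exhibits the barb [w]. Neither [u] nor any other branch shows
    it, so the answer must select the same branch, and releasing the guard leaves [s]. *)
Lemma guarded_choice m w t u s : free_of w t -> free_of w u -> free_of w s ->
  In (DTau, guard w s) m ->
  (forall p x, In (p, x) m -> p = DTau /\ (x = guard w s \/ ~ has_in x w)) ->
  db_bisim (DPar t (DSum m)) (DPar u (DSum m)) -> db_bisim (DPar t s) (DPar u s).
Proof.
  intros Ht Hu Hs Hin Hm H.
  destruct (db_bisim_tau _ _ _ H (tr_par_r t _ _ _ (tr_act _ _ _ Hin))) as (v&Hv&Hb).
  assert (Hw : has_in v w) by (eapply db_bisim_in; [exact Hb|]; apply has_in_par_r, guard_in).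
  apply tr_par_tau in Hv as [(u'&Hu'&->)|[(x&Hx&->)|Hv]].
  - apply has_in_par in Hw as [Hw|(x&Hx)].
    + exfalso. eapply free_of_in; [|exact Hw]. exact (free_of_tau _ _ _ Hu Hu').
    + apply tr_sum_inv in Hx as (p&E&Hx). apply Hm in Hx as [-> _]. discriminate.
  - apply tr_sum_inv in Hx as (p&_&Hx). apply Hm in Hx as [_ [->|Hx]].
    + eapply guard_release; eassumption.
    + apply has_in_par in Hw as [Hw|Hw]; [|contradiction].
      exfalso. eapply free_of_in; [|exact Hw]. assumption.
  - inv Hv; match goal with H : tr (DSum m) _ _ |- _ =>
      apply tr_sum_inv in H as (p&E&H); apply Hm in H as [-> _]; discriminate E end.
Qed.

(** One process refutes all inequivalent candidates: it chooses silently between a tester for the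
    tail of the list and one for its head, each behind a fresh barb of its own. *)
Lemma distinguishing_tester t L :
  exists r, forall u, In u L -> db_bisim (DPar t r) (DPar u r) -> db_equiv t u.
Proof.
  induction L as [|u L (r1&Hr1)]; [exists DNil; contradiction|].
  assert (exists r2, db_bisim (DPar t r2) (DPar u r2) -> db_equiv t u) as (r2&Hr2).
  (* Classical case distinction: either any tester will do, or some tester separates [t] from
     [u]. *)
  { destruct (classic (db_equiv t u)) as [H|H]; [exists DNil; auto|].
    apply not_all_ex_not in H as (r2&Hr2). exists r2. contradiction. }
  destruct (free_of_all (t :: r1 :: r2 :: u :: L)) as (w&Hw).
  assert (Hf : forall v x, w <= v -> In x (t :: r1 :: r2 :: u :: L) -> free_of v x).
  { intros v x Hv Hx. eapply Forall_forall; [apply Hw|]; eassumption. }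
  assert (Hne : forall v v' s, v <> v' -> ~ has_in (guard v s) v').
  { intros v v' s Hv (x&Hx). apply guard_tr in Hx as [E|[E _]]; [|discriminate]. congruence. }
  exists (DSum [(DTau, guard w r1); (DTau, guard (S w) r2)]).
  intros x Hx H. destruct Hx as [<-|Hx].
  - apply Hr2. revert H. apply guarded_choice with (w := S w); try (apply Hf; simpl; auto); simpl; auto.
    intros p y [E|[E|[]]]; injection E as <- <-; auto.
  - apply Hr1; [assumption|]. revert H.
    apply guarded_choice with (w := w); try (apply Hf; simpl; auto 6); simpl; auto.
    intros p y [E|[E|[]]]; injection E as <- <-; auto.
Qed.

(** Finiteness relies on the late semantics: an early input has a residual for every received name.
    The list is an overestimate that pairs transitions irrespective of their channels. *)
Lemma finite_branching t : exists L, forall l t', tr t l t' -> In (l, t') L.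
Proof.
  induction t as [m _|t u (L1&H1) (L2&H2)|t (L&H)] using db_nested_ind.
  - exists (map (fun x => (Act (fst x), snd x)) m). intros l t' Ht.
    apply tr_sum_inv in Ht as (p&->&Hin). apply in_map_iff. now exists (p, t').
  - exists (map (fun x => (fst x, DPar (snd x) (shift (binds (fst x)) u))) L1 ++
            map (fun y => (fst y, DPar (shift (binds (fst y)) t) (snd y))) L2 ++
            flat_map (fun x => flat_map (fun y =>
              match fst x, fst y with
              | Act (DOut _ b), _ => [(Act DTau, DPar (snd x) (ren (inst b) (snd y)))]
              | _, Act (DOut _ b) => [(Act DTau, DPar (ren (inst b) (snd x)) (snd y))]
              | _, _ => [(Act DTau, DNu (DPar (snd x) (snd y)))]
              end) L2) L1).
    intros l v Hv. rewrite !in_app_iff, !in_map_iff, in_flat_map.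
    inv Hv.
    + left. eexists (_, _). split; [|eapply H1; eassumption]. reflexivity.
    + right; left. eexists (_, _). split; [|eapply H2; eassumption]. reflexivity.
    + right; right. eexists (_, _). split; [eapply H1; eassumption|].
      apply in_flat_map. eexists (_, _). split; [eapply H2; eassumption|]. simpl; auto.
    + right; right. eexists (_, _). split; [eapply H1; eassumption|].
      apply in_flat_map. eexists (_, _). split; [eapply H2; eassumption|]. simpl; auto.
    + right; right. eexists (_, _). split; [eapply H1; eassumption|].
      apply in_flat_map. eexists (_, _). split; [eapply H2; eassumption|]. simpl; auto.
    + right; right. eexists (_, _). split; [eapply H1; eassumption|].
      apply in_flat_map. eexists (_, _). split; [eapply H2; eassumption|]. simpl; auto.
  (* Every label is lowered by [pred], whether or not it mentions the restricted name; spurious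
     entries do no harm. *)
  - exists (flat_map (fun x =>
      [(lren pred (fst x), DNu (exch (binds (fst x)) (snd x)));
       (match fst x with Act (DOut a _) => Bout (pred a) | l => l end, snd x)]) L).
    intros l v Hv. rewrite in_flat_map. inv Hv.
    + eexists (_, _). split; [eapply H; eassumption|]. left. simpl. rewrite binds_lren, lren_comp.
      now destruct l as [[]|].
    + eexists (_, _). split; [eapply H; eassumption|]. simpl; auto.
Qed.

(** As [u] has finitely many reducts, one tester [r] refutes all those not equivalent to [t']. It is
    put behind a guard, whose barb survives the move of [t] and forces the answer to be a move of
    [u]. *)
Lemma db_equiv_tau t u t' : db_equiv t u -> tr t (Act DTau) t' -> exists u', tr u (Act DTau) u' /\ db_equiv t' u'.
Proof.
  intros H Ht. destruct (finite_branching u) as (L&HL).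
  destruct (distinguishing_tester t' (map snd L)) as (r&Hr).
  destruct (free_of_all [t; u; r]) as (w&Hw). specialize (Hw w (le_n _)).
  apply Forall_cons_iff in Hw as [Hwt Hw]. apply Forall_cons_iff in Hw as [Hwu Hw].
  apply Forall_cons_iff in Hw as [Hwr _].
  destruct (db_bisim_tau _ _ _ (H (guard w r)) (tr_par_l _ _ _ _ Ht)) as (v&Hv&Hb).
  apply par_guard_tau in Hv as [(u'&Hu&->)| ->]; [| |assumption].
  - exists u'. split; [assumption|]. apply Hr.
    + apply in_map_iff. eexists (_, _). split; [|apply HL, Hu]. reflexivity.
    + apply guard_release with w; eauto using free_of_tau.
  - destruct (free_of_in w (DPar u r)); [now apply free_of_par|].
    eapply db_bisim_in; [exact Hb|]. apply has_in_par_r, guard_in.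
Qed.

(* The tester [s'] interacts as [s] does and loses its barb [w] by interacting, so the matching reduction
   cannot be a step of [u] alone. *)
Lemma db_equiv_com_tester t u s s' v w : db_equiv t u -> free_of w t -> free_of w u -> free_of w s ->
  com t s v -> com t s' v -> has_in s' w -> (forall x, ~ tr s' (Act DTau) x) ->
  (forall v', com u s' v' -> com u s v') ->
  exists v', com u s v' /\ db_equiv v v'.
Proof.
  intros H Ht Hu Hs Hc Hc' Hw Hn Hinv.
  destruct (db_equiv_tau _ _ _ (db_equiv_par_l _ _ s' H) (com_tr _ _ _ Hc')) as (v'&Hv'&Hb).
  exists v'. split; [|assumption].
  assert (Hvw : ~ has_in v' w).
  { intros Hw'. apply (free_of_in w v).
    - apply free_of_tau with (DPar t s); [now apply free_of_par|now apply com_tr].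
    - eapply db_bisim_in; [apply db_bisim_sym, db_equiv_db_bisim, Hb|assumption]. }
  apply tr_par_tau in Hv' as [(u'&_&->)|[(x&Hx&_)|Hv']].
  - destruct Hvw. now apply has_in_par_r.
  - destruct (Hn _ Hx).
  - auto.
Qed.

Lemma sum2_tr p t q u l v : tr (DSum [(p, t); (q, u)]) l v ->
  l = Act p /\ v = t \/ l = Act q /\ v = u.
Proof. intros H. apply tr_sum_inv in H as (c&->&[E|[E|[]]]); injection E as <- <-; auto. Qed.

(** The tester keeps from [s] the prefix used in the interaction, in a sum with an input on a fresh
    [w]. As [u] has no output on [w], it can only interact with the kept prefix. *)
Lemma db_equiv_com t u s v : db_equiv t u -> com t s v -> exists v', com u s v' /\ db_equiv v v'.
Proof.
  intros H Hc. destruct (free_of_all [t; u; s]) as (w&Hw). specialize (Hw w (le_n _)).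
  apply Forall_cons_iff in Hw as [Hwt Hw]. apply Forall_cons_iff in Hw as [Hwu Hw].
  apply Forall_cons_iff in Hw as [Hws _].
  assert (Hno : ~ has_out u w) by now apply free_of_out.
  assert (Hni : ~ has_in u w) by now apply free_of_in.
  pose (trap := fun p x => DSum [(p, x); (DIn w, DNil)]).
  assert (Hp : forall p x, tr (trap p x) (Act p) x) by (intros; apply tr_act; simpl; auto).
  assert (Hwin : forall p x, has_in (trap p x) w) by (intros; exists DNil; apply tr_act; simpl; auto).
  pose proof Hc as Hc'. inv Hc'.
  - eapply db_equiv_com_tester with (s' := trap (DIn a) u'); eauto.
    + econstructor; eauto.
    + intros x Hx. apply sum2_tr in Hx as [[E _]|[E _]]; discriminate.
    + intros v' Hv'. inv Hv';
      match goal with H : tr (trap _ _) _ _ |- _ =>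
        apply sum2_tr in H as [[E ->]|[E ->]]; try discriminate E; injection E as -> end;
      try (econstructor; eassumption); destruct Hno; [left|right]; eauto.
  - eapply db_equiv_com_tester with (s' := trap (DOut a b) u'); eauto.
    + econstructor; eauto.
    + intros x Hx. apply sum2_tr in Hx as [[E _]|[E _]]; discriminate.
    + intros v' Hv'. inv Hv';
      match goal with H : tr (trap _ _) _ _ |- _ =>
        apply sum2_tr in H as [[E ->]|[E ->]]; try discriminate E; injection E; intros; subst end;
      try (econstructor; eassumption); destruct Hno; [left|right]; eauto.
  - eapply db_equiv_com_tester with (s' := trap (DIn a) u'); eauto.
    + econstructor; eauto.
    + intros x Hx. apply sum2_tr in Hx as [[E _]|[E _]]; discriminate.
    + intros v' Hv'. inv Hv';
      match goal with H : tr (trap _ _) _ _ |- _ =>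
        apply sum2_tr in H as [[E ->]|[E ->]]; try discriminate E; injection E as -> end;
      try (econstructor; eassumption); destruct Hno; [left|right]; eauto.
  (* A bound output is not a prefix, so the tester is a restricted sum whose first summand sends the
     restricted name, index 0; [a] and [w] are weakened accordingly. *)
  - pose (q := [(DOut (S a) 0, u'); (DIn (S w), DNil)]).
    assert (Hq : forall l x, tr (DNu (DSum q)) l x ->
      l = Act (DIn w) \/ l = Bout a /\ x = u').
    { intros l x Hx. inv Hx.
      - apply sum2_tr in H3 as [[E _]|[E _]]; destruct l as [[]|]; try discriminate E.
        injection E as ->. auto.
      - apply sum2_tr in H3 as [[E ->]|[E _]]; [|discriminate]. injection E as ->. auto. }
    eapply db_equiv_com_tester with (s' := DNu (DSum q)); eauto.
    + eapply com_close_r; [eassumption|]. apply tr_open, tr_act. simpl. auto.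
    + eexists. apply (tr_res _ (Act (DIn w))), tr_act. simpl. auto.
    + intros x Hx. apply Hq in Hx as [E|[E _]]; discriminate.
    + intros v' Hv'. inv Hv';
      match goal with H : tr (DNu _) _ _ |- _ =>
        apply Hq in H as [E|[E ->]]; try discriminate E; injection E; intros; subst end;
      try (econstructor; eassumption); destruct Hno; [left|right]; eauto.
Qed.

(** One argument is replaced at a time, [com_sym] bringing the other into position. *)
Lemma db_equiv_com2 t u t' u' v : db_equiv t u -> db_equiv t' u' -> com t t' v -> exists v', com u u' v' /\ db_equiv v v'.
Proof.
  intros H H' Hc. destruct (db_equiv_com _ _ _ _ H Hc) as (v1&Hv1&Hb1).
  apply com_sym in Hv1 as (v2&Hv2&Hd2). destruct (db_equiv_com _ _ _ _ H' Hv2) as (v3&Hv3&Hb3).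
  apply com_sym in Hv3 as (v4&Hv4&Hd4). exists v4. split; [assumption|].
  eapply db_equiv_trans; [exact Hb1|]. eapply db_equiv_trans; [apply db_equiv_dc, Hd2|].
  eapply db_equiv_trans; [exact Hb3|]. apply db_equiv_dc, Hd4.
Qed.

(** * The quotient dialgebra by barbed equivalence *)

Lemma barbed_equiv_step1 P Q P' : barbed_equiv P Q -> step1 P P' ->
  exists Q', step1 Q Q' /\ barbed_equiv P' Q'.
Proof.
  intros H HP. apply barbed_equiv_enc in H.
  destruct (proj1 step_tr _ _ HP ident) as (t&Ht&Hd). destruct (db_equiv_tau _ _ _ H Ht) as (u&Hu&Hb).
  destruct (tr_step _ _ _ Hu ident Q inj_ident eq_refl eq_refl) as (Q'&HQ&He).
  exists Q'. split; [assumption|]. apply barbed_equiv_enc.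
  eapply db_equiv_trans; [apply db_equiv_dc, dcong_sym, Hd|]. eapply db_equiv_trans; [exact Hb|]. now apply db_equiv_dc, dcong_sym.
Qed.

Lemma barbed_equiv_step2 P1 P2 Q1 Q2 R : barbed_equiv P1 Q1 -> barbed_equiv P2 Q2 ->
  step2 P1 P2 R -> exists R', step2 Q1 Q2 R' /\ barbed_equiv R R'.
Proof.
  intros H1 H2 HP. apply barbed_equiv_enc in H1. apply barbed_equiv_enc in H2.
  destruct (proj2 step_tr _ _ _ HP ident) as (t&Ht&Hd).
  destruct (db_equiv_com2 _ _ _ _ _ H1 H2 Ht) as (u&Hu&Hb).
  destruct (com_step ident Q1 Q2 u inj_ident Hu) as (R'&HR&He).
  exists R'. split; [assumption|]. apply barbed_equiv_enc.
  eapply db_equiv_trans; [apply db_equiv_dc, dcong_sym, Hd|]. eapply db_equiv_trans; [exact Hb|]. now apply db_equiv_dc, dcong_sym.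
Qed.

Lemma barbed_equiv_sym P Q : barbed_equiv P Q -> barbed_equiv Q P.
Proof. rewrite !barbed_equiv_enc. apply db_equiv_sym. Qed.

Lemma barbed_equiv_refl P : barbed_equiv P P.
Proof. apply barbed_equiv_enc, db_equiv_dc, dcong_refl. Qed.

Lemma barbed_equiv_trans P Q R : barbed_equiv P Q -> barbed_equiv Q R -> barbed_equiv P R.
Proof. rewrite !barbed_equiv_enc. apply db_equiv_trans. Qed.

Lemma barbed_equiv_dial_bisim P Q : barbed_equiv P Q -> dial_bisim pi_dialgebra P Q.
Proof.
  intros HPQ.
  (* The class of a process is represented by the predicate [barbed_equiv P]; extensionality makes
     equality of classes the same as equivalence. *)
  assert (Hcl : forall P Q, barbed_equiv P = barbed_equiv Q <-> barbed_equiv P Q).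
  { intros A B. split.
    - intros ->. apply barbed_equiv_refl.
    - intros H. extensionality C. apply propositional_extensionality.
      split; intros H'; eauto using barbed_equiv_trans, barbed_equiv_sym. }
  (* A class has the transitions of all its members, so the homomorphism condition amounts to the
     two preservation lemmas. *)
  exists (proc -> Prop), (fun u y => exists x, Fmap barbed_equiv x = u /\ Bmap barbed_equiv (pi_dialgebra x) y),
    barbed_equiv.
  split; [|now apply Hcl].
  intros x y. split; [|eauto]. intros (x'&E&R&HR&<-).
  destruct x as [P1|[P1 P2]], x' as [Q1|[Q1 Q2]]; simpl in E, HR; try discriminate.
  - injection E as E. apply Hcl in E. destruct (barbed_equiv_step1 _ _ _ E HR) as (R'&HR'&He).
    exists R'. split; [assumption|]. now apply Hcl, barbed_equiv_sym.
  - injection E as E1 E2. apply Hcl in E1, E2.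
    destruct (barbed_equiv_step2 _ _ _ _ _ E1 E2 HR) as (R'&HR'&He).
    exists R'. split; [assumption|]. now apply Hcl, barbed_equiv_sym.
Qed.

(** * From homomorphisms to barbed equivalence *)

(** The kernel of [h] carried over to de Bruijn terms and closed under [dcong], up to which the
    dialgebra and the late semantics agree. *)
Definition kernel {Y : Type} (h : proc -> Y) (t u : db) : Prop :=
  exists P Q, h P = h Q /\ dcong t (enc ident P) /\ dcong u (enc ident Q).

Lemma kernel_sym {Y : Type} (h : proc -> Y) t u : kernel h t u -> kernel h u t.
Proof. intros (P&Q&E&Ht&Hu). exists Q, P. auto. Qed.

Lemma kernel_tau {Y : Type} (g : dialgebra Y) (h : proc -> Y) t u t' :
  is_hom pi_dialgebra g h -> kernel h t u -> tr t (Act DTau) t' ->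
  exists u', tr u (Act DTau) u' /\ kernel h t' u'.
Proof.
  intros Hh (P&Q&E&Ht&Hu) H. destruct (dcong_tr _ _ _ _ Ht H) as (t1&Ht1&Hd1).
  destruct (tr_step _ _ _ Ht1 ident P inj_ident eq_refl eq_refl) as (P'&HP&Hd).
  assert (Bmap h (pi_dialgebra (inl Q)) (h P')) as (Q'&HQ&E').
  (* The homomorphism condition is used twice: forwards at [P], then backwards at [Q], which has the
     same image. *)
  { apply Hh. simpl. rewrite <- E. apply (Hh (inl P)). now exists P'. }
  simpl in HQ. destruct (proj1 step_tr _ _ HQ ident) as (u1&Hu1&Hd2).
  destruct (dcong_tr _ _ _ _ (dcong_sym _ _ Hu) Hu1) as (u'&Hu'&Hd3).
  exists u'. split; [assumption|]. exists P', Q'.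
  split; [now symmetry|]. split; [apply dcong_trans with t1|apply dcong_trans with u1]; auto using dcong_sym.
Qed.

(** By surjectivity [s] encodes some process [T], and the pairs of [P] and of [Q] with [T] have the
    same image under [Fmap h]. *)
Lemma kernel_com {Y : Type} (g : dialgebra Y) (h : proc -> Y) t u s v :
  is_hom pi_dialgebra g h -> kernel h t u -> com t s v -> exists v', com u s v' /\ kernel h v v'.
Proof.
  intros Hh (P&Q&E&Ht&Hu) H. destruct (enc_surj s) as (T&<-).
  destruct (com_dc _ _ _ _ _ H Ht (dcong_refl _)) as (v1&Hv1&Hd1).
  destruct (com_step ident P T v1 inj_ident Hv1) as (R&HR&Hd).
  assert (Bmap h (pi_dialgebra (inr (Q, T))) (h R)) as (R'&HR'&E').
  { apply Hh. simpl. rewrite <- E. apply (Hh (inr (P, T))). now exists R. }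
  simpl in HR'. destruct (proj2 step_tr _ _ _ HR' ident) as (u1&Hu1&Hd2).
  destruct (com_dc _ _ _ _ _ Hu1 (dcong_sym _ _ Hu) (dcong_refl _)) as (v'&Hv'&Hd3).
  exists v'. split; [assumption|]. exists R, R'.
  split; [now symmetry|]. split; [apply dcong_trans with v1|apply dcong_trans with u1]; auto using dcong_sym.
Qed.

(** An input barb is an interaction with a single output prefix; the payload [a] is an arbitrary
    choice. *)
Lemma kernel_in {Y : Type} (g : dialgebra Y) (h : proc -> Y) t u a :
  is_hom pi_dialgebra g h -> kernel h t u -> has_in t a -> has_in u a.
Proof.
  intros Hh H (t'&Ht).
  assert (Hc : com t (DSum [(DOut a a, DNil)]) (DPar (ren (inst a) t') DNil)).
  { eapply com_com_r; [eassumption|]. apply tr_act. simpl; auto. }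
  destruct (kernel_com _ _ _ _ _ _ Hh H Hc) as (v&Hv&_).
  inv Hv; match goal with H : tr (DSum _) _ _ |- _ =>
    apply tr_sum_inv in H as (p&E&[E'|[]]); injection E' as <- <-; inv E end.
  eexists; eassumption.
Qed.

(** Dually, a single input prefix detects outputs: a free one gives a communication, a bound one a
    close. *)
Lemma kernel_out {Y : Type} (g : dialgebra Y) (h : proc -> Y) t u a :
  is_hom pi_dialgebra g h -> kernel h t u -> has_out t a -> has_out u a.
Proof.
  intros Hh H Ht.
  assert (exists v, com t (DSum [(DIn a, DNil)]) v) as (v&Hc).
  { destruct Ht as [(b&t'&Ht)|(t'&Ht)]; eexists; [eapply com_com_l|eapply com_close_l];
      try eassumption; apply tr_act; simpl; auto. }
  destruct (kernel_com _ _ _ _ _ _ Hh H Hc) as (v'&Hv&_).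
  inv Hv; match goal with H : tr (DSum _) _ _ |- _ =>
    apply tr_sum_inv in H as (p&E&[E'|[]]); injection E' as <- <-; inv E end;
  [left|right]; eauto.
Qed.

Lemma kernel_db_equiv {Y : Type} (g : dialgebra Y) (h : proc -> Y) t u :
  is_hom pi_dialgebra g h -> kernel h t u -> db_equiv t u.
Proof.
  intros Hh H s.
  exists (fun x y => exists t u s, kernel h t u /\ dcong x (DPar t s) /\ dcong y (DPar u s)).
  split; [|exists t, u, s; auto using dcong_refl]. clear t u H s.
  intros x y (t&u&s&H&Hx&Hy). split; [|split; [|split]].
  - exists u, t, s. auto using kernel_sym.
  - intros a Ha. eapply dcong_in; [apply dcong_sym, Hy|]. eapply dcong_in in Ha; [|exact Hx].
    apply has_in_par in Ha as [Ha|Ha]; [|now apply has_in_par_r].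
    apply (kernel_in _ _ _ _ _ Hh H) in Ha as (u'&Hu). eexists. apply tr_par_l. eassumption.
  - intros a Ha. eapply dcong_out; [apply dcong_sym, Hy|]. eapply dcong_out in Ha; [|exact Hx].
    assert (Ho : has_out t a \/ has_out s a).
    { destruct Ha as [(b&z&Hz)|(z&Hz)]; inv Hz; unfold has_out; eauto 6. }
    destruct Ho as [Ho|Ho]; [apply (kernel_out _ _ _ _ _ Hh H) in Ho|];
      destruct Ho as [(b&z&Hz)|(z&Hz)]; [left|right|left|right]; eauto using tr_par_l, tr_par_r.
  - intros x' Hx'. destruct (dcong_tr _ _ _ _ Hx Hx') as (z&Hz&Hd).
    assert (exists z', tr (DPar u s) (Act DTau) z' /\
      exists t u s, kernel h t u /\ dcong z (DPar t s) /\ dcong z' (DPar u s)) as (z'&Hz'&t1&u1&s1&Hk&H1&H2).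
    { apply tr_par_tau in Hz as [(t'&Ht&->)|[(s'&Hs&->)|Hc]].
      - destruct (kernel_tau _ _ _ _ _ Hh H Ht) as (u'&Hu&Hk).
        eexists. split; [apply tr_par_l, Hu|]. exists t', u', s. auto using dcong_refl.
      - eexists. split; [apply tr_par_r, Hs|]. exists t, u, s'. auto using dcong_refl.
      - destruct (kernel_com _ _ _ _ _ _ Hh H Hc) as (v'&Hv&Hk).
        (* An interaction leaves no separate partner behind; [DNil] restores the required shape. *)
        exists v'. split; [now apply com_tr|]. exists z, v', DNil. auto using dcong_unit, dcong_sym. }
    destruct (dcong_tr _ _ _ _ (dcong_sym _ _ Hy) Hz') as (y'&Hy'&Hd').
    exists y'. split; [assumption|]. exists t1, u1, s1. eauto 6 using dcong_trans, dcong_sym.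
Qed.

Theorem theorem5 : forall P Q : proc,
  dial_bisim pi_dialgebra P Q <-> barbed_equiv P Q.
Proof.
  intros P Q. split; [|apply barbed_equiv_dial_bisim].
  intros (Y&g&h&Hh&E). apply barbed_equiv_enc. apply (kernel_db_equiv g h _ _ Hh).
  exists P, Q. auto using dcong_refl.
Qed.
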